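(* Let $M^3$ be a Lagrangian submanifold of the homogeneous nearly Kähler sphere $\mathbb S^6(1)$. In a local oriented orthonormal frame, $$S_{ij,k}=P_{ijk}+P_{jik}+D_{ijk},\qquad D_{ijk}=\tfrac14\sum_m(\omega_{kim}S_{mj}+\omega_{kjm}S_{im}).$$ Moreover, $$\sum_{i,j,k}S_{ij,k}S_{ik,j}=|P|^2+3\sum_{i,j,k}P_{ijk}P_{jik}+\tfrac12\langle A,S\rangle+\tfrac1{16}(s^2-3q).$$
   Context: Everything is smooth. Identify $\mathbb R^7$ with the imaginary Cayley numbers with cross product $X\times Y=\tfrac12(XY-YX)$. The homogeneous nearly Kähler structure on $\mathbb S^6(1)\subset\mathbb R^7$ is the round metric $\langle\cdot,\cdot\rangle$ with $J_xX=x\times X$. Let $\overline\nabla$ be its Levi-Civita connection and $G(X,Y)=(\overline\nabla_XJ)Y$. A Lagrangian submanifold is an immersed 3-manifold $M^3$ with the induced metric such that $J(TM)=T^\perp M$. Let $\nabla,\nabla^\perp$ be the Levi-Civita and normal connections, $h(X,Y)=\overline\nabla_XY-\nabla_XY$ the second fundamental form, and $A_\xi$ the shape operator, $\langle A_\xi X,Y\rangle=\langle h(X,Y),\xi\rangle$. It is known that $M$ is orientable and minimal and that $G(X,Y)$ is normal for tangent $X,Y$. The form $\omega(X,Y,Z)=\langle G(X,Y),JZ\rangle$ is the volume form of $M$ for a suitable orientation, which is fixed. In a local oriented orthonormal frame $\{e_1,e_2,e_3\}$: $\omega_{ijk}=\omega(e_i,e_j,e_k)$ (so $\omega_{123}=1$);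 $h_{ijk}=\langle h(e_i,e_j),Je_k\rangle$ (known to be totally symmetric and trace-free); $S_{ij}=\sum_{a,b}h_{abi}h_{abj}$, $s=|h|^2=\operatorname{tr}S$, $q=\operatorname{tr}(S^2)$; $S_{ij,k}=(\nabla_{e_k}S)(e_i,e_j)$. Set $(\nabla h)(X,Y,Z)=\nabla^\perp_Xh(Y,Z)-h(\nabla_XY,Z)-h(Y,\nabla_XZ)$ and $$T(X,Y,Z)=(\nabla h)(X,Y,Z)-\tfrac14\{G(X,A_{JZ}Y)+G(Y,A_{JX}Z)+G(Z,A_{JY}X)\},$$ $T_{lijk}=\langle T(e_l,e_i,e_j),Je_k\rangle$ (a totally symmetric trace-free tensor). Define $$P_{ijk}=\sum_{a,b}h_{abi}T_{abjk},\quad W_{ij}=\sum_{a,b}\omega_{iab}P_{abj},\quad A_{ij}=\tfrac12(W_{ij}+W_{ji}),$$ with $|P|^2=\sum_{i,j,k} P_{ijk}^2$ and $\langle A,S\rangle=\sum_{i,j}A_{ij}S_{ij}$. (The matrix $A=(A_{ij})$ is not to be confused with the shape operator $A_\xi$.) *)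

(* Defs.v *)
From HB Require Import structures.
From mathcomp Require Import all_boot all_order all_algebra.
From mathcomp Require Import all_classical all_reals all_analysis.

Set Implicit Arguments.
Unset Strict Implicit.
Unset Printing Implicit Defensive.

Import Order.TTheory GRing.Theory Num.Theory.
Import numFieldNormedType.Exports.

Local Open Scope classical_set_scope.
Local Open Scope ring_scope.

(* The Cayley-Dickson doubling of (A, mul, conj):
   (a, b) (c, d) = (a c - d^* b, d a + b c^* ), (a, b)^* = (a^*, - b). *)
Definition cd_mul (A : zmodType) (mul : A -> A -> A) (conj : A -> A)
    (x y : A * A) : A * A :=
  (mul x.1 y.1 - mul (conj y.2) x.2, mul y.2 x.1 + mul x.2 (conj y.1)).

Definition cd_conj (A : zmodType) (conj : A -> A) (x : A * A) : A * A :=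
  (conj x.1, - x.2).

Definition cplx (R : realType) : zmodType := (R * R)%type.
Definition quat (R : realType) : zmodType := (cplx R * cplx R)%type.
Definition cayley (R : realType) : zmodType := (quat R * quat R)%type.

Definition cplx_mul (R : realType) : cplx R -> cplx R -> cplx R :=
  cd_mul (A := R) *%R id.
Definition cplx_conj (R : realType) : cplx R -> cplx R := cd_conj (A := R) id.
Definition quat_mul (R : realType) : quat R -> quat R -> quat R :=
  cd_mul (@cplx_mul R) (@cplx_conj R).
Definition quat_conj (R : realType) : quat R -> quat R :=
  cd_conj (@cplx_conj R).
Definition cayley_mul (R : realType) : cayley R -> cayley R -> cayley R :=
  cd_mul (@quat_mul R) (@quat_conj R).

Definition cayley_im (R : realType) (u : 'rV[R]_7) : cayley R :=
  let c k := u 0 (inord k) in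
  (((0, c 0%N), (c 1%N, c 2%N)), ((c 3%N, c 4%N), (c 5%N, c 6%N))).

Definition im_cayley (R : realType) (x : cayley R) : 'rV[R]_7 :=
  let: (((_, x0), (x1, x2)), ((x3, x4), (x5, x6))) := x in
  \row_(i < 7) [:: x0; x1; x2; x3; x4; x5; x6]`_i.

(* X Y - Y X is imaginary, so no information is lost by [im_cayley]. *)
Definition cross (R : realType) (u v : 'rV[R]_7) : 'rV[R]_7 :=
  2^-1 *: im_cayley (cayley_mul (cayley_im u) (cayley_im v)
                     - cayley_mul (cayley_im v) (cayley_im u)).

Definition dot (R : realType) (n : nat) (u v : 'rV[R]_n) : R :=
  \sum_(i < n) u 0 i * v 0 i.

Fixpoint Ck (R : realType) (V W : normedModType R) (k : nat) (U : set V)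
    (F : V -> W) : Prop :=
  match k with
  | 0 => forall x, U x -> {for x, continuous F}
  | k'.+1 => (forall x, U x -> differentiable F x) /\
             (forall v : V, Ck k' U (fun x => 'D_v F x))
  end.

(* To be used with [U] open. *)
Definition smooth (R : realType) (V W : normedModType R) (U : set V)
    (F : V -> W) : Prop :=
  forall k, Ck k U F.

(* The atlas is indexed by the points of M: [coord p] is a chart defined on
   the neighbourhood [dom p] of [p], with inverse [param p]. *)
Record atlas (R : realType) (M : topologicalType) := Atlas {
  dom : M -> set M;
  coord : M -> M -> 'rV[R]_3;
  param : M -> 'rV[R]_3 -> M;
  dom_open : forall p, open (dom p);
  dom_self : forall p, dom p p;
  coordK : forall p q, dom p q -> param p (coord p q) = q;
  codom_open : forall p, open (coord p @` dom p);
  coord_continuous : forall p, {within dom p, continuous (coord p)};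
  param_continuous : forall p,
    {within coord p @` dom p, continuous (param p)};
  transition_smooth : forall p q,
    smooth (coord p @` (dom p `&` dom q)) (coord q \o param p);
  atlas_hausdorff : hausdorff_space M;
  atlas_second_countable : @second_countable M }.

Section Manifold.
Variables (R : realType) (M : topologicalType) (At : atlas R M).

Definition smooth_map (W : normedModType R) (V : set M) (F : M -> W) : Prop :=
  forall p, smooth (coord At p @` (dom At p `&` V)) (F \o param At p).

(* A tangent vector at p is given by its components in the chart [coord p];
   [der F v p] is the differential of F at p applied to v. *)
Definition der (W : normedModType R) (F : M -> W) (v : 'rV[R]_3) (p : M) : W :=
  'D_v (F \o param At p) (coord At p p).

(* X is smooth on V if its components in every chart of the atlas are. *)
Definition smooth_field (V : set M) (X : M -> 'rV[R]_3) : Prop :=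
  forall q, smooth_map (V `&` dom At q) (fun p => der (coord At q) (X p) p).

(* A connection on a bundle over M whose smooth sections over an open set V
   are described by [sec V]; the values of a section outside V are junk. *)
Record connection (W : normedModType R) (sec : set M -> (M -> W) -> Prop)
    (D : (M -> 'rV[R]_3) -> (M -> W) -> M -> W) : Prop := Connection {
  conn_section : forall V X s, open V -> smooth_field V X -> sec V s ->
    sec V (D X s);
  conn_local : forall V X X' s s', open V ->
    smooth_field V X -> smooth_field V X' -> sec V s -> sec V s' ->
    (forall p, V p -> X p = X' p) -> (forall p, V p -> s p = s' p) ->
    forall p, V p -> D X s p = D X' s' p;
  conn_linear : forall V X X' (a : M -> R) s, open V ->
    smooth_field V X -> smooth_field V X' -> smooth_map V (a : M -> R^o) ->
    sec V s -> forall p, V p ->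
    D (fun q => a q *: X q + X' q) s p = a p *: D X s p + D X' s p;
  conn_add : forall V X s s', open V -> smooth_field V X ->
    sec V s -> sec V s' -> forall p, V p ->
    D X (fun q => s q + s' q) p = D X s p + D X s' p;
  conn_leibniz : forall V X (a : M -> R) s, open V -> smooth_field V X ->
    smooth_map V (a : M -> R^o) -> sec V s -> forall p, V p ->
    D X (fun q => a q *: s q) p =
      der (a : M -> R^o) (X p) p *: s p + a p *: D X s p }.

End Manifold.

Section Sphere.
Variable R : realType.
Implicit Types (X Y Z : 'rV[R]_7 -> 'rV[R]_7) (x u v : 'rV[R]_7).

Definition sphere6 : set 'rV[R]_7 := [set x | dot x x = 1].

(* A vector field on the sphere is represented by a smooth extension to R^7;
   only its values on the sphere matter. *)
Definition sphere_field X : Prop :=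
  smooth [set: 'rV[R]_7] X /\ forall x, sphere6 x -> dot (X x) x = 0.

Record sphere_levi_civita
    (nb : ('rV[R]_7 -> 'rV[R]_7) -> ('rV[R]_7 -> 'rV[R]_7) ->
          'rV[R]_7 -> 'rV[R]_7) : Prop := SphereLeviCivita {
  slc_field : forall X Y, sphere_field X -> sphere_field Y ->
    sphere_field (nb X Y);
  slc_linear : forall X X' (a : 'rV[R]_7 -> R) Y,
    sphere_field X -> sphere_field X' -> sphere_field Y ->
    smooth [set: 'rV[R]_7] (a : 'rV[R]_7 -> R^o) ->
    forall x, sphere6 x ->
    nb (fun y => a y *: X y + X' y) Y x = a x *: nb X Y x + nb X' Y x;
  slc_add : forall X Y Y',
    sphere_field X -> sphere_field Y -> sphere_field Y' ->
    forall x, sphere6 x ->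
    nb X (fun y => Y y + Y' y) x = nb X Y x + nb X Y' x;
  slc_leibniz : forall X (a : 'rV[R]_7 -> R) Y,
    sphere_field X -> sphere_field Y ->
    smooth [set: 'rV[R]_7] (a : 'rV[R]_7 -> R^o) ->
    forall x, sphere6 x ->
    nb X (fun y => a y *: Y y) x =
      'D_(X x) (a : 'rV[R]_7 -> R^o) x *: Y x + a x *: nb X Y x;
  slc_metric : forall X Y Z,
    sphere_field X -> sphere_field Y -> sphere_field Z ->
    forall x, sphere6 x ->
    'D_(X x) ((fun y => dot (Y y) (Z y)) : 'rV[R]_7 -> R^o) x =
      dot (nb X Y x) (Z x) + dot (Y x) (nb X Z x);
  slc_torsion : forall X Y, sphere_field X -> sphere_field Y ->
    forall x, sphere6 x ->
    nb X Y x - nb Y X x = 'D_(X x) Y x - 'D_(Y x) X x }.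

Definition Jop x v : 'rV[R]_7 := cross x v.

(* A vector field on the sphere extending the tangent vector [u]. *)
Definition ext u : 'rV[R]_7 -> 'rV[R]_7 := fun y => u - dot u y *: y.

(* (nabla_u J) v at x, for u, v tangent to the sphere at x; being tensorial,
   it does not depend on the chosen extensions of u and v. *)
Definition Gten nb x u v : 'rV[R]_7 :=
  nb (ext u) (fun y => Jop y (ext v y)) x - Jop x (nb (ext u) (ext v) x).

End Sphere.

Section Submanifold.
Variables (R : realType) (M : topologicalType) (At : atlas R M).
Variable f : M -> 'rV[R]_7.
Implicit Types (X Y Z : M -> 'rV[R]_3) (xi : M -> 'rV[R]_7) (V : set M).

Definition normal_vector (p : M) (w : 'rV[R]_7) : Prop :=
  dot w (f p) = 0 /\ forall v, dot w (der At f v p) = 0.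

Record lagrangian : Prop := Lagrangian {
  lag_smooth : smooth_map At [set: M] f;
  lag_sphere : forall p, sphere6 (f p);
  lag_immersion : forall p v, der At f v p = 0 -> v = 0;
  lag_normal : forall p w,
    normal_vector p w <-> exists v, w = Jop (f p) (der At f v p) }.

Definition gmet (p : M) (u v : 'rV[R]_3) : R :=
  dot (der At f u p) (der At f v p).

Record levi_civita
    (nabla : (M -> 'rV[R]_3) -> (M -> 'rV[R]_3) -> M -> 'rV[R]_3) : Prop :=
  LeviCivita {
  lc_connection : connection At (smooth_field At) nabla;
  lc_metric : forall V X Y Z, open V -> smooth_field At V X ->
    smooth_field At V Y -> smooth_field At V Z -> forall p, V p ->
    der At ((fun q => gmet q (Y q) (Z q)) : M -> R^o) (X p) p =
      gmet p (nabla X Y p) (Z p) + gmet p (Y p) (nabla X Z p);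
  (* nabla_X Y - nabla_Y X = [X, Y], as derivations of smooth functions *)
  lc_torsion : forall V X Y (a : M -> R^o), open V -> smooth_field At V X ->
    smooth_field At V Y -> smooth_map At V a -> forall p, V p ->
    der At a (nabla X Y p - nabla Y X p) p =
      der At (fun q => der At a (Y q) q) (X p) p
      - der At (fun q => der At a (X q) q) (Y p) p }.

(* Vector fields of the sphere along f, i.e. sections of the pullback by f
   of its tangent bundle. *)
Definition sphere_section V (s : M -> 'rV[R]_7) : Prop :=
  smooth_map At V s /\ forall p, V p -> dot (s p) (f p) = 0.

(* [nbf] is the connection induced by [nb] on vector fields along f. *)
Record pullback_connection
    (nb : ('rV[R]_7 -> 'rV[R]_7) -> ('rV[R]_7 -> 'rV[R]_7) ->
          'rV[R]_7 -> 'rV[R]_7)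
    (nbf : (M -> 'rV[R]_3) -> (M -> 'rV[R]_7) -> M -> 'rV[R]_7) : Prop :=
  PullbackConnection {
  pb_connection : connection At sphere_section nbf;
  pb_compose : forall V X (Xb Yb : 'rV[R]_7 -> 'rV[R]_7), open V ->
    smooth_field At V X -> sphere_field Xb -> sphere_field Yb ->
    forall p, V p -> Xb (f p) = der At f (X p) p ->
    nbf X (Yb \o f) p = nb Xb Yb (f p) }.

Definition pushf X : M -> 'rV[R]_7 := fun p => der At f (X p) p.

Definition normal_section V xi : Prop :=
  smooth_map At V xi /\ forall p, V p -> normal_vector p (xi p).

Section Extrinsic.
Variable nb : ('rV[R]_7 -> 'rV[R]_7) -> ('rV[R]_7 -> 'rV[R]_7) ->
              'rV[R]_7 -> 'rV[R]_7.
Variable nbf : (M -> 'rV[R]_3) -> (M -> 'rV[R]_7) -> M -> 'rV[R]_7.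
Variable nabla : (M -> 'rV[R]_3) -> (M -> 'rV[R]_3) -> M -> 'rV[R]_3.

(* nabla^perp_X xi is the normal component of the ambient derivative of xi. *)
Definition normal_connection
    (nperp : (M -> 'rV[R]_3) -> (M -> 'rV[R]_7) -> M -> 'rV[R]_7) : Prop :=
  forall V X xi, open V -> smooth_field At V X -> normal_section V xi ->
  forall p, V p -> normal_vector p (nperp X xi p) /\
    exists v, nbf X xi p = der At f v p + nperp X xi p.

Definition sff X Y : M -> 'rV[R]_7 :=
  fun p => nbf X (pushf Y) p - pushf (nabla X Y) p.

Definition shape_operator
    (Ash : (M -> 'rV[R]_7) -> (M -> 'rV[R]_3) -> M -> 'rV[R]_3) : Prop :=
  forall V xi X Y, open V -> normal_section V xi ->
  smooth_field At V X -> smooth_field At V Y -> forall p, V p ->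
  gmet p (Ash xi X p) (Y p) = dot (sff X Y p) (xi p).

Definition Jf X : M -> 'rV[R]_7 := fun p => Jop (f p) (pushf X p).

Definition Gf X Y : M -> 'rV[R]_7 :=
  fun p => Gten nb (f p) (pushf X p) (pushf Y p).

Definition omega X Y Z (p : M) : R := dot (Gf X Y p) (Jf Z p).

Variable nperp : (M -> 'rV[R]_3) -> (M -> 'rV[R]_7) -> M -> 'rV[R]_7.
Variable Ash : (M -> 'rV[R]_7) -> (M -> 'rV[R]_3) -> M -> 'rV[R]_3.

Definition nabla_sff X Y Z : M -> 'rV[R]_7 :=
  fun p => nperp X (sff Y Z) p - sff (nabla X Y) Z p - sff Y (nabla X Z) p.

Definition Tten X Y Z : M -> 'rV[R]_7 :=
  fun p => nabla_sff X Y Z p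
    - 4^-1 *: (Gf X (Ash (Jf Z) Y) p + Gf Y (Ash (Jf X) Z) p
               + Gf Z (Ash (Jf Y) X) p).

Definition nabla_bilin (B : (M -> 'rV[R]_3) -> (M -> 'rV[R]_3) -> M -> R)
    X Y Z (p : M) : R :=
  der At (B Y Z : M -> R^o) (X p) p
  - B (nabla X Y) Z p - B Y (nabla X Z) p.

(* Orientation: omega is a positive multiple of the volume form, so a frame is
   oriented iff omega is positive on it. *)
Definition oriented_orthonormal_frame V (e : 'I_3 -> M -> 'rV[R]_3) : Prop :=
  [/\ forall i, smooth_field At V (e i),
      forall p, V p -> forall i j, gmet p (e i p) (e j p) = (i == j)%:R &
      forall p, V p ->
        0 < omega (e (inord 0)) (e (inord 1)) (e (inord 2)) p].

Variable e : 'I_3 -> M -> 'rV[R]_3.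
Implicit Types (i j k l : 'I_3) (p : M).

Definition om_ i j k p : R := omega (e i) (e j) (e k) p.

(* The tensor S, with its trace taken in the orthonormal frame [e];
   S(e_i, e_j) unfolds to the sum of the h_abi h_abj. *)
Definition Sten X Y p : R :=
  \sum_a \sum_b dot (sff (e a) (e b) p) (Jf X p)
                * dot (sff (e a) (e b) p) (Jf Y p).

Definition h_ i j k p : R := dot (sff (e i) (e j) p) (Jf (e k) p).

Definition S_ i j p : R := Sten (e i) (e j) p.

Definition Smx p : 'M[R]_3 := \matrix_(i, j) S_ i j p.

Definition s_ p : R := \tr (Smx p).

Definition q_ p : R := \tr (Smx p *m Smx p).

Definition dS_ i j k p : R := nabla_bilin Sten (e k) (e i) (e j) p.

Definition T_ l i j k p : R := dot (Tten (e l) (e i) (e j) p) (Jf (e k) p).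

Definition P_ i j k p : R := \sum_a \sum_b h_ a b i p * T_ a b j k p.

Definition W_ i j p : R := \sum_a \sum_b om_ i a b p * P_ a b j p.

Definition A_ i j p : R := 2^-1 * (W_ i j p + W_ j i p).

End Extrinsic.
End Submanifold.

(* Main.v *)
(* Write [F X] for the differential of [f] applied to [X].  Koszul's argument
   identifies both given connections with projected derivatives in R^7, so
   [D_X (F Y) = F (nabla_X Y) + h(X, Y) - <X, Y> f].  Being Lagrangian means
   [<f x F Y, F Z> = 0]; differentiating this once shows that the cubic form
   [<h(X, Y), J Z>] is symmetric and that products [F X x F Y] are normal, and
   differentiating [<F X x F Y, F Z> = 0] shows that the form is trace-free.
   The Codazzi equation is the commutation of derivatives in R^7.
   For a symmetric trace-free cubic form in dimension 3 the rest is algebra: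
   the derivative of the components [h_ijk] differs from [nabla h] by the term
   [F X x F W] coming from the derivative of [J W = f x F W], and the
   correction in the definition of [T] makes [T] totally symmetric.  The
   Christoffel symbols drop out of [S_ij,k] because they are skew. *)
Require Import Defs.
From HB Require Import structures.
From mathcomp Require Import all_boot all_order all_algebra.
From mathcomp Require Import all_classical all_reals all_analysis.
From mathcomp Require Import ring lra.
Import Order.TTheory GRing.Theory Num.Theory.
Import numFieldNormedType.Exports.
Local Open Scope classical_set_scope.
Local Open Scope ring_scope.

Set Implicit Arguments.
Unset Strict Implicit.

(** * The cross product of R^7 *)

Section CrossProduct.
Context {R : realType}.
Implicit Types (u v w : 'rV[R]_7).

Lemma dotE u v : dot u v =
  let c (w : 'rV[R]_7) k := w 0 (inord k) in
  c u 0%N * c v 0%N + c u 1%N * c v 1%N + c u 2%N * c v 2%N + c u 3%N * c v 3%N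
  + c u 4%N * c v 4%N + c u 5%N * c v 5%N + c u 6%N * c v 6%N.
Proof.
have -> : dot u v = \sum_(i < 7) u 0 (inord i) * v 0 (inord i).
  by apply: eq_bigr => i _; rewrite inord_val.
rewrite -(big_mkord xpredT (fun i => u 0 (inord i) * v 0 (inord i))).
by rewrite !big_nat_recr //= big_geq // add0r.
Qed.

Lemma crossE u v : cross u v =
  let a k := u 0 (inord k) in let b k := v 0 (inord k) in
  let m i j := a i * b j - a j * b i in
  \row_(i < 7) [:: m 1 2 + m 3 4 + m 6 5; m 2 0 + m 3 5 + m 4 6;
    m 0 1 + m 3 6 + m 5 4; m 4 0 + m 5 1 + m 6 2; m 0 3 + m 6 1 + m 2 5;
    m 0 6 + m 1 3 + m 4 2; m 5 0 + m 1 4 + m 2 3]`_i.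
Proof.
apply/rowP => i; rewrite /cross /im_cayley /cayley_im /=.
rewrite !mxE.
case: i => -[|[|[|[|[|[|[|//]]]]]]] ? /=; by field.
Qed.

Lemma dotC n (u v : 'rV[R]_n) : dot u v = dot v u.
Proof. by apply: eq_bigr => i _; rewrite mulrC. Qed.

Lemma dotDl n (u v w : 'rV[R]_n) : dot (u + v) w = dot u w + dot v w.
Proof. by rewrite -big_split; apply: eq_bigr => i _; rewrite mxE mulrDl. Qed.

Lemma dotZl n (a : R) (u w : 'rV[R]_n) : dot (a *: u) w = a * dot u w.
Proof. by rewrite mulr_sumr; apply: eq_bigr => i _; rewrite mxE mulrA. Qed.

Lemma dotDr n (u v w : 'rV[R]_n) : dot w (u + v) = dot w u + dot w v.
Proof. by rewrite dotC dotDl !(dotC w). Qed.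

Lemma dotZr n (a : R) (u w : 'rV[R]_n) : dot w (a *: u) = a * dot w u.
Proof. by rewrite dotC dotZl dotC. Qed.

Lemma dotNl n (u w : 'rV[R]_n) : dot (- u) w = - dot u w.
Proof. by rewrite -scaleN1r dotZl mulN1r. Qed.

Lemma dotNr n (u w : 'rV[R]_n) : dot w (- u) = - dot w u.
Proof. by rewrite dotC dotNl dotC. Qed.

Lemma dot0l n (w : 'rV[R]_n) : dot 0 w = 0.
Proof. by rewrite -(scale0r 0) dotZl mul0r. Qed.

Lemma dot0r n (w : 'rV[R]_n) : dot w 0 = 0.
Proof. by rewrite dotC dot0l. Qed.

Definition dotE_lin := (dotDl, dotDr, dotZl, dotZr, dotNl, dotNr, dot0l, dot0r).

Lemma dot_sumr n (I : finType) (w : 'rV[R]_n) (u : I -> 'rV[R]_n) :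
  dot w (\sum_i u i) = \sum_i dot w (u i).
Proof.
apply: (big_morph (dot w)) => [u1 u2|]; [exact: dotDr|exact: dot0r].
Qed.

Lemma dot_delta n (w : 'rV[R]_n) i : dot w 'e_i = w 0 i.
Proof.
rewrite /dot (bigD1 i)//= mxE !eqxx mulr1 big1 ?addr0// => j ji.
by rewrite mxE (negPf ji) andbF mulr0.
Qed.

Lemma dot_eq0 n (w : 'rV[R]_n) : dot w w = 0 -> w = 0.
Proof.
move=> /eqP; rewrite psumr_eq0; last by move=> i _; rewrite -expr2 sqr_ge0.
move=> /allP w0; apply/rowP => i; rewrite mxE; apply/eqP.
by have := w0 i (mem_index_enum i); rewrite -expr2 sqrf_eq0.
Qed.

Lemma crossDl u v w : cross (u + v) w = cross u w + cross v w.
Proof.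
apply/rowP; rewrite !crossE => i; rewrite !mxE.
case: i => -[|[|[|[|[|[|[|//]]]]]]] ? /=; ring.
Qed.

Lemma crossZl (a : R) u w : cross (a *: u) w = a *: cross u w.
Proof.
apply/rowP; rewrite !crossE => i; rewrite !mxE.
case: i => -[|[|[|[|[|[|[|//]]]]]]] ? /=; ring.
Qed.

Lemma crossC u v : cross u v = - cross v u.
Proof.
apply/rowP; rewrite !crossE => i; rewrite !mxE.
case: i => -[|[|[|[|[|[|[|//]]]]]]] ? /=; ring.
Qed.

Lemma crossDr u v w : cross w (u + v) = cross w u + cross w v.
Proof. by rewrite crossC crossDl opprD -!crossC. Qed.

Lemma crossZr (a : R) u w : cross w (a *: u) = a *: cross w u.
Proof. by rewrite crossC crossZl -scalerN -crossC. Qed.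

Lemma crossNr u w : cross w (- u) = - cross w u.
Proof. by rewrite -scaleN1r crossZr scaleN1r. Qed.

Lemma crossNl u w : cross (- u) w = - cross u w.
Proof. by rewrite -scaleN1r crossZl scaleN1r. Qed.

Lemma cross0r w : cross w 0 = 0.
Proof. by have := crossZr 0 0 w; rewrite !scale0r. Qed.

Lemma crossxx w : cross w w = 0.
Proof.
apply/rowP; rewrite !crossE => i; rewrite !mxE.
case: i => -[|[|[|[|[|[|[|//]]]]]]] ? /=; ring.
Qed.

Lemma cross_sumr (I : finType) w (u : I -> 'rV[R]_7) :
  cross w (\sum_i u i) = \sum_i cross w (u i).
Proof.
apply: (big_morph (cross w)) => [u1 u2|]; [exact: crossDr|exact: cross0r].
Qed.

Lemma dot_cross_cyc u v w : dot (cross u v) w = dot u (cross v w).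
Proof. rewrite !dotE /= !crossE !mxE !inordK //=; ring. Qed.

(* The polarization of [|a x b|^2 = |a|^2 |b|^2 - <a, b>^2] in [b]. *)
Lemma dot_cross_cross (a b c d : 'rV[R]_7) :
  dot (cross a b) (cross c d) + dot (cross a d) (cross c b) =
  2 * dot a c * dot b d - dot a d * dot b c - dot a b * dot c d.
Proof. rewrite !dotE /= !crossE !mxE !inordK //=; ring. Qed.

End CrossProduct.

(** * Cubic forms in dimension three *)

Section TensorAlgebra.
Context {R : realType}.
Implicit Types (i j k l m a b : 'I_3).

Let o0 : 'I_3 := @Ordinal 3 0 isT.
Let o1 : 'I_3 := @Ordinal 3 1 isT.
Let o2 : 'I_3 := @Ordinal 3 2 isT.

Lemma sum3 (V : nmodType) (F : 'I_3 -> V) : \sum_i F i = F o0 + F o1 + F o2.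
Proof.
rewrite !big_ord_recr big_ord0 /= add0r.
by congr (F _ + F _ + F _); apply: val_inj.
Qed.

Lemma ord3_ind (Q : 'I_3 -> Prop) : Q o0 -> Q o1 -> Q o2 -> forall i, Q i.
Proof.
move=> q0 q1 q2 [[|[|[|//]]] li]; rewrite (bool_irrelevance li isT).
- exact: q0.
- exact: q1.
- exact: q2.
Qed.

Definition eps3 i j k : R :=
  match val i, val j, val k with
  | 0%N, 1%N, 2%N | 1%N, 2%N, 0%N | 2%N, 0%N, 1%N => 1
  | 1%N, 0%N, 2%N | 2%N, 1%N, 0%N | 0%N, 2%N, 1%N => -1
  | _, _, _ => 0
  end.

Lemma sum_eps01 (G : 'I_3 -> R) : \sum_m eps3 o0 o1 m * G m = G o2.
Proof. by rewrite sum3 /eps3 /= !mul0r mul1r !add0r. Qed.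

Lemma sum_eps12 (G : 'I_3 -> R) : \sum_m eps3 o1 o2 m * G m = G o0.
Proof. by rewrite sum3 /eps3 /= !mul0r mul1r !addr0. Qed.

Lemma sum_eps20 (G : 'I_3 -> R) : \sum_m eps3 o2 o0 m * G m = G o1.
Proof. by rewrite sum3 /eps3 /= !mul0r mul1r add0r addr0. Qed.

Lemma alternating_eps3 (om : 'I_3 -> 'I_3 -> 'I_3 -> R) :
  (forall i j k, om i j k = - om j i k) ->
  (forall i j k, om i j k = - om i k j) ->
  0 < om (inord 0) (inord 1) (inord 2) ->
  \sum_m om (inord 0) (inord 1) m ^+ 2 = 1 ->
  forall i j k, om i j k = eps3 i j k.
Proof.
move=> alt1 alt2.
have -> : inord 0 = o0 by apply: val_inj; rewrite /= inordK.
have -> : inord 1 = o1 by apply: val_inj; rewrite /= inordK.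
have -> : inord 2 = o2 by apply: val_inj; rewrite /= inordK.
have omii i j : om i i j = 0 by have := alt1 i i j; lra.
have omjj i j : om i j j = 0 by have := alt2 i j j; lra.
have omij i j : om i j i = 0 by rewrite alt1 omjj oppr0.
move=> om_gt0; rewrite sum3 omij omjj expr0n/= !add0r => /eqP.
rewrite sqrf_eq1 => /orP[/eqP om1|/eqP om1]; last first.
  by move: om_gt0; rewrite om1 oppr_gt0 ltr10.
have om2 : om o1 o2 o0 = 1 by rewrite alt2 alt1 !opprK.
have om3 : om o2 o0 o1 = 1 by rewrite alt1 alt2 !opprK.
apply: ord3_ind; apply: ord3_ind; apply: ord3_ind;
  rewrite /eps3 /= ?omii ?omjj ?omij ?om1 ?om2 ?om3 // alt1 ?om1 ?om2 ?om3 //.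
Qed.

Lemma skew_contraction_eq0 (G h h' : 'I_3 -> 'I_3 -> R) :
  (forall a b, G a b = - G b a) ->
  \sum_a \sum_b
    ((\sum_m G a m * h m b + \sum_m G b m * h a m) * h' a b
     + (\sum_m G a m * h' m b + \sum_m G b m * h' a m) * h a b) = 0.
Proof.
move=> skew; have Gii a : G a a = 0 by have := skew a a; lra.
rewrite !sum3 !Gii (skew o1 o0) (skew o2 o0) (skew o2 o1); ring.
Qed.

Section SecondFundamentalForm.
Variable h : 'I_3 -> 'I_3 -> 'I_3 -> R.
Hypothesis hC12 : forall i j k, h i j k = h j i k.
Hypothesis hC23 : forall i j k, h i j k = h i k j.
Hypothesis h_trace : forall i, \sum_m h i m m = 0.

(* A symmetric trace-free cubic form in dimension 3 has seven free
   components. *)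
Let hmodel (a b c d e f g : R) i j k : R :=
  nth 0 (nth [::] (nth [::]
    [:: [:: [:: a; b; c]; [:: b; d; e]; [:: c; e; - a - d]];
        [:: [:: b; d; e]; [:: d; f; g]; [:: e; g; - b - f]];
        [:: [:: c; e; - a - d]; [:: e; g; - b - f];
            [:: - a - d; - b - f; - c - g]]] i) j) k.

Let hE : h = hmodel (h o0 o0 o0) (h o0 o0 o1) (h o0 o0 o2) (h o0 o1 o1)
  (h o0 o1 o2) (h o1 o1 o1) (h o1 o1 o2).
Proof.
have t0 : h o0 o2 o2 = - h o0 o0 o0 - h o0 o1 o1.
  by have := h_trace o0; rewrite sum3; lra.
have t1 : h o1 o2 o2 = - h o0 o0 o1 - h o1 o1 o1.
  by have := h_trace o1; rewrite sum3 (hC12 o1 o0 o0) (hC23 o0 o1 o0); lra.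
have t2 : h o2 o2 o2 = - h o0 o0 o2 - h o1 o1 o2.
  have := h_trace o2; rewrite sum3 (hC12 o2 o0 o0) (hC23 o0 o2 o0).
  by rewrite (hC12 o2 o1 o1) (hC23 o1 o2 o1); lra.
apply/funext => i; apply/funext => j; apply/funext => k.
move: i j k; apply: ord3_ind; apply: ord3_ind; apply: ord3_ind;
  rewrite /hmodel /= ?t0 ?t1 ?t2 //.
all: rewrite -?t0 -?t1 -?t2.
all: by [rewrite hC12|rewrite hC23|rewrite hC12 hC23|rewrite hC23 hC12|
  rewrite hC12 hC23 hC12|rewrite hC23 hC12 hC23].
Qed.

(* In components [T = nabla h - codazzi_correction / 4]. *)
Definition codazzi_correction l i j k : R :=
  \sum_m (h i m j * eps3 l m k + h j m l * eps3 i m k + h l m i * eps3 j m k).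

Let E := codazzi_correction.

Let hC13 i j k : h i j k = h k j i.
Proof. by rewrite hC12 hC23 hC12. Qed.

Let corr12 l i j k : E l i j k = E i l j k.
Proof.
rewrite /E /codazzi_correction; apply: eq_bigr => m _.
by rewrite (hC13 j m l) (hC13 j m i) (hC13 i m l); ring.
Qed.

Let corr23 l i j k : E l i j k = E l j i k.
Proof.
rewrite /E /codazzi_correction; apply: eq_bigr => m _.
by rewrite (hC13 j m l) (hC13 j m i) (hC13 i m l); ring.
Qed.

Let corr34 l i j k :
  \sum_m eps3 l j m * h i k m - \sum_m eps3 l k m * h i j m =
  4^-1 * (E l i j k - E l i k j).
Proof.
rewrite /E /codazzi_correction !sum3 hE.
by move: l i j k; do 4 apply: ord3_ind; rewrite /hmodel /eps3 /=; field.
Qed.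

Lemma contraction_identity i j k :
  \sum_a \sum_b
    ((4^-1 * E k a b i + \sum_m eps3 k i m * h a b m) * h a b j
     + (4^-1 * E k a b j + \sum_m eps3 k j m * h a b m) * h a b i) =
  4^-1 * \sum_m (eps3 k i m * (\sum_a \sum_b h a b m * h a b j)
                 + eps3 k j m * (\sum_a \sum_b h a b i * h a b m)).
Proof.
rewrite /E /codazzi_correction !sum3 hE.
by move: i j k; do 3 apply: ord3_ind; rewrite /hmodel /eps3 /=; field.
Qed.

Section CovariantDerivative.
Variable N : 'I_3 -> 'I_3 -> 'I_3 -> 'I_3 -> R.
Hypothesis NC12 : forall l i j k, N l i j k = N i l j k.
Hypothesis NC23 : forall l i j k, N l i j k = N l j i k.
Hypothesis NC34 : forall l i j k,
  N l i j k + \sum_m eps3 l k m * h i j m =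
  N l i k j + \sum_m eps3 l j m * h i k m.

Let T l i j k := N l i j k - 4^-1 * E l i j k.

Lemma TC12 l i j k : T l i j k = T i l j k.
Proof. by rewrite /T NC12 corr12. Qed.

Lemma TC23 l i j k : T l i j k = T l j i k.
Proof. by rewrite /T NC23 corr23. Qed.

Lemma TC34 l i j k : T l i j k = T l i k j.
Proof. by have := NC34 l i j k; have := corr34 l i j k; rewrite /T; lra. Qed.

Let P i j k := \sum_a \sum_b h a b i * T a b j k.

Lemma dS_decomposition i j k :
  \sum_a \sum_b ((N k a b i + \sum_m eps3 k i m * h a b m) * h a b j
                 + (N k a b j + \sum_m eps3 k j m * h a b m) * h a b i) =
  P i j k + P j i k
  + 4^-1 * \sum_m (eps3 k i m * (\sum_a \sum_b h a b m * h a b j)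
                   + eps3 k j m * (\sum_a \sum_b h a b i * h a b m)).
Proof.
rewrite -contraction_identity /P -!big_split /=; apply: eq_bigr => a _.
rewrite -!big_split /=; apply: eq_bigr => b _.
have TE c : T a b c k = N k a b c - 4^-1 * E k a b c.
  by rewrite TC34 TC23 TC12.
by rewrite !TE; ring.
Qed.

End CovariantDerivative.
End SecondFundamentalForm.

Lemma dS_quadratic (P : 'I_3 -> 'I_3 -> 'I_3 -> R) (S : 'I_3 -> 'I_3 -> R) :
  (forall i j k, P i j k = P i k j) -> (forall i j, S i j = S j i) ->
  let D i j k := 4^-1 * \sum_m (eps3 k i m * S m j + eps3 k j m * S i m) in
  let X i j k := P i j k + P j i k + D i j k in
  let W i j := \sum_a \sum_b eps3 i a b * P a b j in
  \sum_i \sum_j \sum_k X i j k * X i k j =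
    \sum_i \sum_j \sum_k P i j k ^+ 2
    + 3 * (\sum_i \sum_j \sum_k P i j k * P j i k)
    + 2^-1 * (\sum_i \sum_j 2^-1 * (W i j + W j i) * S i j)
    + 16^-1 * ((\sum_i S i i) ^+ 2 - 3 * \sum_i \sum_j S i j * S j i).
Proof.
move=> PC SC D X W; rewrite /X /D /W !sum3 /eps3 /=.
rewrite !(PC _ o1 o0) !(PC _ o2 o0) !(PC _ o2 o1).
rewrite !(SC o1 o0) !(SC o2 o0) !(SC o2 o1).
by field.
Qed.

End TensorAlgebra.

(** * Calculus of smooth maps *)

Section SmoothCalculus.
Context {R : realType}.

Definition cbilinear (U V W : normedModType R) (B : U -> V -> W) : Prop :=
  [/\ forall v, linear (B^~ v), forall u, linear (B u) &
      continuous (fun p : U * V => B p.1 p.2)].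

Lemma derive_comp (E U W : normedModType R) (F : E -> U) (G : U -> W) x v :
  differentiable F x -> differentiable G (F x) ->
  'D_v (G \o F) x = 'D_('D_v F x) G (F x).
Proof.
move=> dF dG; have dGF := differentiable_comp dF dG.
by rewrite (deriveE v dGF) (deriveE _ dG) (deriveE v dF) diff_comp.
Qed.

Lemma diff_cbilinear (U V W E : normedModType R) (B : U -> V -> W)
    (F : E -> U) (G : E -> V) x : cbilinear B ->
  differentiable F x -> differentiable G x ->
  differentiable (fun y => B (F y) (G y)) x /\
  forall v, 'D_v (fun y => B (F y) (G y)) x =
            B ('D_v F x) (G x) + B (F x) ('D_v G x).
Proof.
move=> [Bl Br Bc] dF dG.
have bilB : bilinear_for
    (GRing.Scale.Law.clone _ _ *:%R _) (GRing.Scale.Law.clone _ _ *:%R _) B.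
  by split=> [v|u] a y z /=; [exact: Bl|exact: Br].
pose BM := bilinear_isBilinear.Build R U V W _ _ B bilB.
pose BB : {bilinear U -> V -> W} := HB.pack B BM.
have dP := differentiable_pair dF dG.
have dB : differentiable (fun p : U * V => BB p.1 p.2) (F x, G x).
  exact: differentiable_bilin.
split=> [|v]; first exact: (differentiable_comp dP dB).
have e1 := derive_comp v dP dB.
have e2 : 'D_v (fun y => (F y, G y)) x = ('D_v F x, 'D_v G x).
  by rewrite (deriveE v dP) diff_pair//= (deriveE v dF) (deriveE v dG).
have e3 := deriveE ('D_v F x, 'D_v G x) dB.
rewrite diff_bilin// in e3.
rewrite e2 e3 in e1.
by rewrite addrC; exact: e1.
Qed.

Lemma near_differentiable (E W : normedModType R) (F G : E -> W) x :
  {near x, F =1 G} -> differentiable F x -> differentiable G x.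
Proof.
move=> FG dF; have [cF eF] := (diff_locallyP x F).1 dF.
have eG : G \o shift x = cst (G x) + 'd F x +o_ 0 id.
  apply/eqaddoP => e e0; have /eqaddoP/(_ e e0) := eF.
  have FGx := nbhs_singleton FG.
  move: FG; rewrite (near_shift 0) subr0 => FG.
  apply: filterS2 FG => y /= FGy.
  by rewrite !fctE /= FGx FGy.
by apply/diff_locallyP; rewrite (diff_unique cF eG).
Qed.

Lemma Ck_eq (E W : normedModType R) k (U : set E) (F G : E -> W) :
  open U -> (forall x, U x -> F x = G x) -> Ck k U F -> Ck k U G.
Proof.
move=> oU; elim: k F G => [|k IH] F G FG /=.
  move=> cF x Ux; have := cF x Ux; rewrite /prop_for /continuous_at -(FG x Ux).
  apply: cvg_trans; apply: near_eq_cvg.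
  by apply: filterS (open_nbhs_nbhs (conj oU Ux)) => y /FG.
have nFG x : U x -> {near x, F =1 G}.
  by move=> Ux; exact: (filterS FG (open_nbhs_nbhs (conj oU Ux))).
move=> [dF CF]; split=> [x Ux|v].
  exact: near_differentiable (nFG x Ux) (dF x Ux).
by apply: IH (CF v) => x /nFG; exact: near_eq_derive.
Qed.

Lemma CkW (E W : normedModType R) k (U : set E) (F : E -> W) :
  Ck k.+1 U F -> Ck k U F.
Proof.
elim: k F => [|k IH] F [dF CF]; first by move=> x /dF/differentiable_continuous.
by split=> // v; apply: IH; exact: CF.
Qed.

Lemma Ck_sub (E W : normedModType R) k (U U' : set E) (F : E -> W) :
  U' `<=` U -> Ck k U F -> Ck k U' F.
Proof.
move=> UU; elim: k F => [|k IH] F /=; first by move=> CF x /UU/CF.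
by move=> [dF CF]; split=> [x /UU/dF//|v]; apply: IH.
Qed.

Lemma CkD (E W : normedModType R) k (U : set E) (F G : E -> W) : open U ->
  Ck k U F -> Ck k U G -> Ck k U (fun x => F x + G x).
Proof.
move=> oU; elim: k F G => [|k IH] F G /=.
  by move=> CF CG x Ux; apply: continuousD; [exact: CF|exact: CG].
move=> [dF CF] [dG CG]; split=> [x Ux|v].
  by apply: differentiableD; [exact: dF|exact: dG].
apply: (Ck_eq oU _ (IH _ _ (CF v) (CG v))) => x Ux.
by rewrite deriveD//; apply: diff_derivable; [exact: dF|exact: dG].
Qed.

Lemma Ck_cbilinear (E U V W : normedModType R) k (B : U -> V -> W) (A : set E)
    (F : E -> U) (G : E -> V) : open A -> cbilinear B ->
  Ck k A F -> Ck k A G -> Ck k A (fun x => B (F x) (G x)).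
Proof.
move=> oA cB; elim: k F G => [|k IH] F G.
  move=> /= CF CG x Ax; have [_ _ cBB] := cB.
  apply: (@continuous_comp _ _ _ (fun x => (F x, G x)) (fun p => B p.1 p.2)).
    by apply: cvg_pair; [exact: CF|exact: CG].
  exact: cBB.
move=> CF CG; have [dF DF] := CF; have [dG DG] := CG.
split=> [x Ax|v].
  by have [] := diff_cbilinear cB (dF x Ax) (dG x Ax).
apply: (Ck_eq oA) (CkD oA (IH _ _ (DF v) (CkW CG)) (IH _ _ (CkW CF) (DG v))).
by move=> x Ax; have [_ ->] := diff_cbilinear cB (dF x Ax) (dG x Ax).
Qed.

Lemma Ck_cst (E W : normedModType R) k (A : set E) (w : W) :
  Ck k A (fun _ => w).
Proof.
elim: k w => [|k IH] w /=; first by move=> x _; exact: cst_continuous.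
split=> [x _|v]; first exact: differentiable_cst.
rewrite (_ : (fun x => _) = (fun _ : E => 0 : W))//.
by apply/funext => x; exact: derive_cst.
Qed.

Lemma differentiable_idfun (E : normedModType R) (x : E) :
  differentiable (fun y : E => y) x.
Proof. exact: (@ex_diff _ _ _ _ _ id). Qed.

Lemma Ck_id (E : normedModType R) k (A : set E) : Ck k A (fun x => x).
Proof.
case: k => [|k] /=; first by move=> x _; exact: cvg_id.
split=> [x _|v]; first exact: differentiable_idfun.
rewrite (_ : (fun x => _) = (fun _ : E => v)); first exact: Ck_cst.
by apply/funext => x; exact: derive_id.
Qed.

Lemma smooth_cst (E W : normedModType R) (A : set E) (w : W) :
  smooth A (fun _ => w).
Proof. by move=> k; exact: Ck_cst. Qed.

Lemma smooth_id (E : normedModType R) (A : set E) : smooth A (fun x => x).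
Proof. by move=> k; exact: Ck_id. Qed.

Lemma smoothD (E W : normedModType R) (A : set E) (F G : E -> W) : open A ->
  smooth A F -> smooth A G -> smooth A (fun x => F x + G x).
Proof. by move=> oA sF sG k; apply: CkD. Qed.

Lemma smooth_cbilinear (E U V W : normedModType R) (B : U -> V -> W) (A : set E)
    (F : E -> U) (G : E -> V) : open A -> cbilinear B ->
  smooth A F -> smooth A G -> smooth A (fun x => B (F x) (G x)).
Proof. by move=> oA cB sF sG k; apply: Ck_cbilinear. Qed.

Lemma smooth_eq (E W : normedModType R) (A : set E) (F G : E -> W) :
  open A -> (forall x, A x -> F x = G x) -> smooth A F -> smooth A G.
Proof. by move=> oA FG sF k; apply: Ck_eq (sF k). Qed.

Lemma smooth_sub (E W : normedModType R) (A A' : set E) (F : E -> W) :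
  A' `<=` A -> smooth A F -> smooth A' F.
Proof. by move=> AA sF k; apply: Ck_sub (sF k). Qed.

Lemma smooth_differentiable (E W : normedModType R) (A : set E) (F : E -> W) x :
  smooth A F -> A x -> differentiable F x.
Proof. by move=> /(_ 1%N)[+ _]; exact. Qed.

Lemma smooth_derive (E W : normedModType R) (A : set E) (F : E -> W) v :
  smooth A F -> smooth A ('D_v F).
Proof. by move=> sF k; have [_] := sF k.+1; exact. Qed.

Lemma smooth_sum (E W : normedModType R) (A : set E) (I : finType)
  (F : I -> E -> W) : open A -> (forall i, smooth A (F i)) ->
  smooth A (fun x => \sum_i F i x).
Proof.
move=> oA sF; rewrite (_ : (fun x => _) = \sum_i F i); last first.
  by apply/funext => x; rewrite fct_sumE.
apply: (big_ind (smooth A)) => //; first exact: smooth_cst.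
by move=> G H; exact: smoothD.
Qed.

Lemma cbilinear_scale (W : normedModType R) :
  cbilinear ((fun a w => a *: w) : R^o -> W -> W).
Proof.
split=> [w a x y|a b x y|].
- by rewrite scalerDl scalerA.
- by rewrite scalerDr !scalerA mulrC.
- exact: scale_continuous.
Qed.

Lemma linear_sumZ (V W : lmodType R) (L : V -> W) (I : finType) (c : I -> R)
    (v : I -> V) : linear L -> L (\sum_i c i *: v i) = \sum_i c i *: L (v i).
Proof.
move=> linL; have L0 : L 0 = 0.
  by have := linL (-1) 0 0; rewrite scaler0 addr0 scaleN1r addNr.
have LD u w : L (u + w) = L u + L w by have := linL 1 u w; rewrite !scale1r.
rewrite (big_morph L LD L0); apply: eq_bigr => i _.
by have := linL (c i) (v i) 0; rewrite L0 !addr0.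
Qed.

Lemma linear_rV_sum (n : nat) (W : normedModType R) (L : 'rV[R]_n -> W) v :
  linear L -> L v = \sum_i v 0 i *: L 'e_i.
Proof.
by move=> linL; rewrite {1}(row_sum_delta v) linear_sumZ.
Qed.

Lemma cbilinear_rV (n m : nat) (W : normedModType R)
    (B : 'rV[R]_n.+1 -> 'rV[R]_m.+1 -> W) :
  (forall v, linear (B^~ v)) -> (forall u, linear (B u)) -> cbilinear B.
Proof.
move=> Bl Br; split=> //.
rewrite (_ : (fun p => _) = (fun p : 'rV_n.+1 * 'rV_m.+1 => \sum_i \sum_j
    p.1 0 i *: (p.2 0 j *: B 'e_i 'e_j))); last first.
  apply/funext => p; rewrite (linear_rV_sum p.1 (Bl p.2)).
  apply: eq_bigr => i _; rewrite (linear_rV_sum p.2 (Br _)).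
  by rewrite scaler_sumr.
have addc : continuous (fun x : W * W => x.1 + x.2) by exact: add_continuous.
apply: (continuous_big addc) => i _; apply: (continuous_big addc) => j _ p.
have c1 : (fun x : 'rV[R]_n.+1 * 'rV[R]_m.+1 => x.1 0 i : R^o) @ p -->
    (p.1 0 i : R^o).
  apply: (@continuous_comp ('rV[R]_n.+1 * 'rV[R]_m.+1)%type 'rV[R]_n.+1 R^o fst
    (fun u => u 0 i)); [exact: cvg_fst|exact: coord_continuous].
have c2 : (fun x : 'rV[R]_n.+1 * 'rV[R]_m.+1 => x.2 0 j : R^o) @ p -->
    (p.2 0 j : R^o).
  apply: (@continuous_comp ('rV[R]_n.+1 * 'rV[R]_m.+1)%type 'rV[R]_m.+1 R^o snd
    (fun u => u 0 j)); [exact: cvg_snd|exact: coord_continuous].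
by apply: cvgZ c1 _; apply: cvgZ c2 _; exact: cvg_cst.
Qed.

Lemma cbilinear_dot (n : nat) :
  cbilinear (@dot R n.+1 : 'rV[R]_n.+1 -> 'rV[R]_n.+1 -> R^o).
Proof.
by apply: cbilinear_rV => u a v w; rewrite !dotE_lin.
Qed.

Lemma cbilinear_cross : cbilinear (@cross R).
Proof.
apply: cbilinear_rV => u a v w; first by rewrite crossDl crossZl.
by rewrite crossDr crossZr.
Qed.

Lemma derive_linear (E W : normedModType R) (F : E -> W) x :
  differentiable F x -> linear (fun v => 'D_v F x).
Proof. by move=> dF a u v; rewrite !(deriveE _ dF) linearP. Qed.

End SmoothCalculus.

(** * Derivatives on a manifold *)

Section ManifoldCalculus.
Context {R : realType} {M : topologicalType} (At : atlas R M).
Implicit Types (V : set M) (p q : M) (v : 'rV[R]_3) (X : M -> 'rV[R]_3).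

Lemma chart_open q V : open V -> open (Defs.coord At q @` (dom At q `&` V)).
Proof.
move=> oV.
rewrite (_ : _ @` _ = (Defs.coord At q @` dom At q) `&` param At q @^-1` V).
  have cq := @param_continuous _ _ At q.
  rewrite continuous_open_subspace in cq; last exact: codom_open.
  apply: (proj1 (continuous_inP (param At q) (@codom_open _ _ At q)) cq V).
  exact: oV.
apply/seteqP; split=> [_ [r [qr Vr] <-]|_ [[r qr <-]]] /=.
  by split; [exists r|rewrite coordK].
by rewrite coordK// => Vr; exists r.
Qed.

Lemma chart_mem p V :
  V p -> (Defs.coord At p @` (dom At p `&` V)) (Defs.coord At p p).
Proof. by move=> Vp; exists p => //; split => //; exact: dom_self. Qed.

Lemma chart_near p V (Q : 'rV[R]_3 -> Prop) : open V -> V p ->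
  (forall r, dom At p r -> V r -> Q (Defs.coord At p r)) ->
  \forall y \near Defs.coord At p p, Q y.
Proof.
move=> oV Vp QP.
have := open_nbhs_nbhs (conj (@chart_open p V oV) (chart_mem Vp)).
by apply: filterS => _ [r [pr Vr] <-]; exact: QP.
Qed.

Section OverOpenSet.
Variable V : set M.
Hypothesis oV : open V.

Lemma smooth_map_eq (W : normedModType R) (F G : M -> W) :
  (forall p, V p -> F p = G p) -> smooth_map At V F -> smooth_map At V G.
Proof.
move=> FG sF q; apply: smooth_eq (sF q); first exact: chart_open.
by move=> _ [r [qr Vr] <-] /=; rewrite coordK// FG.
Qed.

Lemma smooth_map_sub (W : normedModType R) (V' : set M) (F : M -> W) :
  V' `<=` V -> smooth_map At V F -> smooth_map At V' F.
Proof.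
move=> VV sF q; apply: smooth_sub (sF q) => _ [r [qr /VV Vr] <-].
by exists r.
Qed.

Lemma smooth_map_cst (W : normedModType R) (w : W) :
  smooth_map At V (fun _ => w).
Proof. by move=> q; exact: smooth_cst. Qed.

Lemma smooth_mapD (W : normedModType R) (F G : M -> W) :
  smooth_map At V F -> smooth_map At V G ->
  smooth_map At V (fun p => F p + G p).
Proof.
by move=> sF sG q; apply: (smoothD _ (sF q) (sG q)); exact: chart_open.
Qed.

Lemma smooth_map_cbilinear (U U' W : normedModType R) (B : U -> U' -> W)
    (F : M -> U) (G : M -> U') : cbilinear B ->
  smooth_map At V F -> smooth_map At V G ->
  smooth_map At V (fun p => B (F p) (G p)).
Proof.
move=> cB sF sG q; apply: (smooth_cbilinear _ cB (sF q) (sG q)).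
exact: chart_open.
Qed.

Lemma smooth_map_sum (W : normedModType R) (I : finType) (F : I -> M -> W) :
  (forall i, smooth_map At V (F i)) -> smooth_map At V (fun p => \sum_i F i p).
Proof.
move=> sF q; apply: (@smooth_sum _ _ _ _ _ (fun i => F i \o param At q)).
  exact: chart_open.
by move=> i; exact: sF.
Qed.

Lemma smooth_mapZ (W : normedModType R) (a : M -> R) (F : M -> W) :
  smooth_map At V (a : M -> R^o) -> smooth_map At V F ->
  smooth_map At V (fun p => a p *: F p).
Proof. exact: smooth_map_cbilinear (cbilinear_scale W). Qed.

Lemma smooth_mapM (a b : M -> R) :
  smooth_map At V (a : M -> R^o) -> smooth_map At V (b : M -> R^o) ->
  smooth_map At V ((fun p => a p * b p) : M -> R^o).
Proof. exact: smooth_map_cbilinear (cbilinear_scale R^o). Qed.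

Lemma smooth_mapB (W : normedModType R) (F G : M -> W) :
  smooth_map At V F -> smooth_map At V G ->
  smooth_map At V (fun p => F p - G p).
Proof.
move=> sF sG; under [X in smooth_map _ _ X]funext do rewrite -scaleN1r.
by apply: smooth_mapD sF _; apply: smooth_mapZ sG; exact: smooth_map_cst.
Qed.

Lemma smooth_map_dot n (F G : M -> 'rV[R]_n.+1) :
  smooth_map At V F -> smooth_map At V G ->
  smooth_map At V ((fun p => dot (F p) (G p)) : M -> R^o).
Proof. exact: smooth_map_cbilinear (cbilinear_dot n). Qed.

Lemma smooth_map_cross (F G : M -> 'rV[R]_7) :
  smooth_map At V F -> smooth_map At V G ->
  smooth_map At V (fun p => cross (F p) (G p)).
Proof. exact: smooth_map_cbilinear cbilinear_cross. Qed.

Variable p : M.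
Hypothesis Vp : V p.

Lemma smooth_map_differentiable (W : normedModType R) (F : M -> W) :
  smooth_map At V F -> differentiable (F \o param At p) (Defs.coord At p p).
Proof. by move=> /(_ p)/smooth_differentiable; apply; exact: chart_mem. Qed.

Lemma der_eq (W : normedModType R) (F G : M -> W) v :
  (forall q, V q -> F q = G q) -> der At F v p = der At G v p.
Proof.
move=> FG; apply: near_eq_derive; apply: chart_near oV Vp _ => r pr Vr /=.
by rewrite coordK// FG.
Qed.

Lemma der_cst (W : normedModType R) (w : W) v : der At (fun _ => w) v p = 0.
Proof. exact: derive_cst. Qed.

Lemma derD (W : normedModType R) (F G : M -> W) v :
  smooth_map At V F -> smooth_map At V G ->
  der At (fun q => F q + G q) v p = der At F v p + der At G v p.
Proof.
move=> /smooth_map_differentiable dF /smooth_map_differentiable dG.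
by apply: (@deriveD _ _ _ (F \o param At p) (G \o param At p));
  exact: diff_derivable.
Qed.

Lemma der_cbilinear (U U' W : normedModType R) (B : U -> U' -> W)
    (F : M -> U) (G : M -> U') v : cbilinear B ->
  smooth_map At V F -> smooth_map At V G ->
  der At (fun q => B (F q) (G q)) v p =
    B (der At F v p) (G p) + B (F p) (der At G v p).
Proof.
move=> cB /smooth_map_differentiable dF /smooth_map_differentiable dG.
have [_ e] := diff_cbilinear cB dF dG; have := e v.
by rewrite /= !coordK//; exact: dom_self.
Qed.

Lemma derZ (W : normedModType R) (a : M -> R) (F : M -> W) v :
  smooth_map At V (a : M -> R^o) -> smooth_map At V F ->
  der At (fun q => a q *: F q) v p =
    der At (a : M -> R^o) v p *: F p + a p *: der At F v p.
Proof. exact: der_cbilinear (cbilinear_scale W). Qed.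

Lemma derM (a b : M -> R) v :
  smooth_map At V (a : M -> R^o) -> smooth_map At V (b : M -> R^o) ->
  der At ((fun q => a q * b q) : M -> R^o) v p =
    der At (a : M -> R^o) v p * b p + a p * der At (b : M -> R^o) v p.
Proof. exact: der_cbilinear (cbilinear_scale R^o). Qed.

Lemma derB (W : normedModType R) (F G : M -> W) v :
  smooth_map At V F -> smooth_map At V G ->
  der At (fun q => F q - G q) v p = der At F v p - der At G v p.
Proof.
move=> /smooth_map_differentiable dF /smooth_map_differentiable dG.
by apply: (@deriveB _ _ _ (F \o param At p) (G \o param At p));
  exact: diff_derivable.
Qed.

Lemma der_dot n (F G : M -> 'rV[R]_n.+1) v :
  smooth_map At V F -> smooth_map At V G ->
  der At ((fun q => dot (F q) (G q)) : M -> R^o) v p =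
    dot (der At F v p) (G p) + dot (F p) (der At G v p).
Proof. exact: der_cbilinear (cbilinear_dot n). Qed.

Lemma der_cross (F G : M -> 'rV[R]_7) v :
  smooth_map At V F -> smooth_map At V G ->
  der At (fun q => cross (F q) (G q)) v p =
    cross (der At F v p) (G p) + cross (F p) (der At G v p).
Proof. exact: der_cbilinear cbilinear_cross. Qed.

Lemma der_sum (W : normedModType R) (I : finType) (F : I -> M -> W) v :
  (forall i, smooth_map At V (F i)) ->
  der At (fun q => \sum_i F i q) v p = \sum_i der At (F i) v p.
Proof.
move=> sF.
pose Q (G : M -> W) (w : W) := smooth_map At V G /\ der At G v p = w.
suff [_] : Q (\sum_i F i) (\sum_i der At (F i) v p).
  by rewrite (_ : \sum_i F i = (fun q => \sum_i F i q))//; apply/funext => q;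
    rewrite fct_sumE.
apply: (big_ind2 Q); first by split; [exact: smooth_map_cst|exact: der_cst].
  move=> G w G' w' [sG <-] [sG' <-].
  by split; [exact: smooth_mapD|exact: derD].
by move=> i _; split.
Qed.

Lemma der_linear (W : normedModType R) (F : M -> W) : smooth_map At V F ->
  linear (fun v => der At F v p).
Proof. by move=> /smooth_map_differentiable; exact: derive_linear. Qed.

Lemma der_comp (W W' : normedModType R) (F : M -> W) (G : W -> W') v :
  smooth_map At V F -> differentiable G (F p) ->
  der At (G \o F) v p = 'D_(der At F v p) G (F p).
Proof.
move=> /smooth_map_differentiable dF dG; rewrite /der -compA derive_comp//=.
  by rewrite coordK//; exact: dom_self.
by rewrite coordK//; exact: dom_self.
Qed.

Lemma coord_differentiable q : dom At q p ->
  differentiable (Defs.coord At q \o param At p) (Defs.coord At p p).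
Proof.
move=> qp; apply: smooth_differentiable (transition_smooth At p q) _.
by exists p => //; split=> //; exact: dom_self.
Qed.

Lemma der_chart (W : normedModType R) (F : M -> W) q v : dom At q p ->
  smooth_map At V F ->
  der At F v p =
  'D_(der At (Defs.coord At q) v p) (F \o param At q) (Defs.coord At q p).
Proof.
move=> qp sF.
have dq := coord_differentiable qp.
have pp : param At p (Defs.coord At p p) = p.
  by rewrite coordK//; exact: dom_self.
have dF : differentiable (F \o param At q) (Defs.coord At q p).
  by apply: smooth_differentiable (sF q) _; exists p.
have := @derive_comp _ _ _ _ (Defs.coord At q \o param At p) (F \o param At q)
  (Defs.coord At p p) v dq.
rewrite /= pp => /(_ dF) <-.
apply: near_eq_derive.
apply: (chart_near (V := dom At q)) => [|//|r pr qr /=]; first exact: dom_open.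
by rewrite !coordK.
Qed.

End OverOpenSet.

Lemma smooth_map_der V (W : normedModType R) (F : M -> W) X : open V ->
  smooth_map At V F -> smooth_field At V X ->
  smooth_map At V (fun p => der At F (X p) p).
Proof.
move=> oV sF sX q.
have oq : open (Defs.coord At q @` (dom At q `&` V)) by exact: chart_open.
pose xi := (fun p => der At (Defs.coord At q) (X p) p) \o param At q.
have sxi : smooth (Defs.coord At q @` (dom At q `&` V)) xi.
  by apply: smooth_sub (sX q q) => _ [r [qr Vr] <-]; exists r.
pose G := fun y =>
  \sum_(i < 3) (dot (xi y) 'e_i) *: 'D_'e_i (F \o param At q) y.
apply: (@smooth_eq _ _ _ _ G) => //.
  move=> _ [r [qr Vr] <-]; rewrite /G /xi /= coordK//.
  rewrite (der_chart Vr _ qr sF).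
  have dF : differentiable (F \o param At q) (Defs.coord At q r).
    by apply: smooth_differentiable (sF q) _; exists r.
  rewrite (linear_rV_sum _ (derive_linear dF)); apply: eq_bigr => i _.
  by rewrite dot_delta.
apply: smooth_sum => // i.
apply: (smooth_cbilinear oq (cbilinear_scale W)); last exact: smooth_derive.
by apply: (smooth_cbilinear oq (cbilinear_dot 2)) => //; exact: smooth_cst.
Qed.

End ManifoldCalculus.

(** * The connections on the sphere and along f *)

Lemma subr_exchange (A : zmodType) (a b c d : A) :
  a - b = c - d -> a - c = b - d.
Proof.
by move=> e; rewrite -(subrK b a) e addrAC (addrAC c) subrr add0r addrC.
Qed.

(* The algebraic core of Koszul's formula. *)
Lemma sym_skew_eq0 (R : realType) (T : Type) (P : T -> Prop)
    (b : T -> T -> T -> R) :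
  (forall x y z, P x -> P y -> b x y z = b y x z) ->
  (forall x y z, P x -> P y -> P z -> b x y z = - b x z y) ->
  forall x y z, P x -> P y -> P z -> b x y z = 0.
Proof.
move=> sym skew x y z Px Py Pz.
have e1 := skew _ _ _ Px Py Pz; have e2 := sym x z y Px Pz.
have e3 := skew _ _ _ Pz Px Py; have e4 := sym z y x Pz Py.
have e5 := skew _ _ _ Py Pz Px; have e6 := sym y x z Py Px.
by lra.
Qed.

Lemma metric_skew (R : realType) n (a b c d y z : 'rV[R]_n) :
  dot a z + dot y b = dot c z + dot y d ->
  dot (c - a) z = - dot (d - b) y.
Proof. by rewrite !dotE_lin !(dotC y) => e; lra. Qed.

Section SphereConnection.
Context {R : realType}.
Implicit Types (x u v w : 'rV[R]_7) (X Y Z : 'rV[R]_7 -> 'rV[R]_7).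

Lemma dot_crossr u v : dot (cross u v) v = 0.
Proof. by rewrite dot_cross_cyc crossxx dot0r. Qed.

Lemma dot_crossl u v : dot (cross u v) u = 0.
Proof. by rewrite crossC dotNl dot_crossr oppr0. Qed.

Lemma extE u y : ext u y = u + dot (- u) y *: y.
Proof. by rewrite /ext dotNl scaleNr. Qed.

Lemma smooth_ext u : smooth [set: 'rV[R]_7] (ext u).
Proof.
rewrite (funext (extE u)); apply: smoothD => //; first exact: openT.
  exact: smooth_cst.
apply: (smooth_cbilinear openT (cbilinear_scale 'rV[R]_7)).
  by apply: (smooth_cbilinear openT (cbilinear_dot 6));
    [exact: smooth_cst|exact: smooth_id].
exact: smooth_id.
Qed.

Lemma derive_ext u v x : 'D_v (ext u) x = - dot u v *: x - dot u x *: v.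
Proof.
have did := @differentiable_idfun R 'rV[R]_7 x.
have [d1 e1] := diff_cbilinear (cbilinear_dot 6)
  (differentiable_cst (- u) x) did.
have [d2 e2] := diff_cbilinear (cbilinear_scale 'rV[R]_7) d1 did.
rewrite (funext (extE u)).
rewrite (@deriveD _ _ _ (cst u)
  (fun y => dot (- u) y *: y)); [|exact: diff_derivable..].
have Did : 'D_v (fun y : 'rV[R]_7 => y) x = v by exact: derive_id.
have Dcst w : 'D_v (cst w : 'rV[R]_7 -> 'rV[R]_7) x = 0 by exact: derive_cst.
rewrite Dcst (e2 v) (e1 v) Did Dcst dot0l !dotNl add0r add0r.
by rewrite -[RHS]/(- dot u v *: x + - (dot u x *: v)) -[in RHS]scaleNr.
Qed.

Lemma ext_tangent u x : dot u x = 0 -> ext u x = u.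
Proof. by move=> ux; rewrite /ext ux scale0r subr0. Qed.

Lemma sphere_field_ext u : sphere_field (ext u).
Proof.
split=> [|x x1]; first exact: smooth_ext.
by rewrite /ext !dotE_lin x1 mulr1 subrr.
Qed.

Variable nb : ('rV[R]_7 -> 'rV[R]_7) -> ('rV[R]_7 -> 'rV[R]_7) ->
              'rV[R]_7 -> 'rV[R]_7.
Hypothesis hnb : sphere_levi_civita nb.

Lemma sphere_connectionE X Y x :
  sphere_field X -> sphere_field Y -> sphere6 x ->
  nb X Y x = 'D_(X x) Y x - dot ('D_(X x) Y x) x *: x.
Proof.
move=> sX sY x1.
have b0 Z : sphere_field Z -> dot (nb X Y x - 'D_(X x) Y x) (Z x) = 0.
  apply: (sym_skew_eq0 (P := @sphere_field R)
    (b := fun X Y Z => dot (nb X Y x - 'D_(X x) Y x) (Z x))) sX sY.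
    move=> X' Y' Z' sX' sY'; have := slc_torsion hnb sX' sY' x1.
    by move=> /subr_exchange ->.
  move=> X' Y' Z' sX' sY' sZ'; have := slc_metric hnb sX' sY' sZ' x1.
  have [_ ->] := diff_cbilinear (cbilinear_dot 6)
    (smooth_differentiable (sY'.1) (I : [set: _] x))
    (smooth_differentiable (sZ'.1) (I : [set: _] x)).
  exact: metric_skew.
set d := 'D_(X x) Y x; have nx := (slc_field hnb sX sY).2 x x1.
apply/eqP; rewrite -subr_eq0; apply/eqP; apply: dot_eq0.
set w := _ - _; have wx : dot w x = 0.
  by rewrite /w !dotE_lin nx x1 mulr1 subrr subrr.
have := b0 (ext w) (sphere_field_ext w); rewrite ext_tangent// -/d => bw.
by rewrite {1}/w opprB addrA addrAC dotDl bw dotZl (dotC x) wx mulr0 addr0.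
Qed.

Lemma sphere_field_J_ext v : sphere_field (fun y => Jop y (ext v y)).
Proof.
split=> [|x _]; last exact: dot_crossl.
apply: (smooth_cbilinear openT cbilinear_cross); first exact: smooth_id.
exact: smooth_ext.
Qed.

Lemma GtenE x u v : sphere6 x -> dot u x = 0 -> dot v x = 0 ->
  Gten nb x u v = cross u v - dot (cross u v) x *: x.
Proof.
move=> x1 ux vx; rewrite /Gten !sphere_connectionE//;
  try exact: sphere_field_ext; last exact: sphere_field_J_ext.
rewrite !ext_tangent// derive_ext vx scale0r subr0 dotZl x1 mulr1 subrr.
rewrite /Jop cross0r subr0.
have did := @differentiable_idfun R 'rV[R]_7 x.
have [_ ->] := diff_cbilinear cbilinear_cross did
    (smooth_differentiable (smooth_ext v) (I : [set: _] x)).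
rewrite derive_ext vx scale0r subr0 ext_tangent// crossZr crossxx scaler0 addr0.
by rewrite (_ : 'D_u _ x = u) //; exact: derive_id.
Qed.

End SphereConnection.

Section PullbackConnection.
Context {R : realType} {M : topologicalType} {At : atlas R M}.
Context {f : M -> 'rV[R]_7}.
Context {nb : ('rV[R]_7 -> 'rV[R]_7) -> ('rV[R]_7 -> 'rV[R]_7) ->
              'rV[R]_7 -> 'rV[R]_7}.
Context {nbf : (M -> 'rV[R]_3) -> (M -> 'rV[R]_7) -> M -> 'rV[R]_7}.
Hypothesis smooth_f : smooth_map At [set: M] f.
Hypothesis sphere_f : forall p, sphere6 (f p).
Hypothesis hnb : sphere_levi_civita nb.
Hypothesis hnbf : pullback_connection At f nb nbf.
Implicit Types (s : M -> 'rV[R]_7).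

Lemma dot_der_position v p : dot (der At f v p) (f p) = 0.
Proof.
have := der_dot (V := [set: M]) (p := p) I v smooth_f smooth_f.
rewrite (der_eq At openT (p := p) I (G := fun _ => 1 : R^o) v
  (fun q _ => sphere_f q)) der_cst.
by rewrite (dotC (f p)); lra.
Qed.

Section AlongField.
Context {V : set M} {X : M -> 'rV[R]_3} {p : M}.
Hypotheses (oV : open V) (sX : smooth_field At V X) (Vp : V p).

Let fV : smooth_map At V f.
Proof. exact: smooth_map_sub smooth_f. Qed.

Let projected_der s :=
  der At s (X p) p - dot (der At s (X p) p) (f p) *: f p.

Let nbf_formula s := sphere_section At f V s /\ nbf X s p = projected_der s.

Let nbf_formulaD s s' : nbf_formula s -> nbf_formula s' ->
  nbf_formula (fun q => s q + s' q).
Proof.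
move=> [ss es] [ss' es']; split.
  split=> [|q Vq]; first exact: smooth_mapD ss.1 ss'.1.
  by rewrite dotDl ss.2// ss'.2// addr0.
rewrite (conn_add (pb_connection hnbf) oV sX ss ss' Vp) es es' /projected_der.
by rewrite (derD Vp _ ss.1 ss'.1) dotDl scalerDl opprD addrACA.
Qed.

Let nbf_formula0 : nbf_formula (fun _ => 0).
Proof.
have ss : sphere_section At f V (fun _ => 0).
  by split=> [|q _]; [exact: smooth_map_cst|rewrite dot0l].
split=> //; have := conn_add (pb_connection hnbf) oV sX ss ss Vp.
rewrite (_ : (fun q => 0 + 0) = (fun _ => 0)); last first.
  by apply/funext => q; rewrite addr0.
move/eqP; rewrite -subr_eq0 opprD addNKr oppr_eq0 => /eqP ->.
by rewrite /projected_der der_cst dot0l scale0r subrr.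
Qed.

Let nbf_formula_ext (a : M -> R) u : smooth_map At V (a : M -> R^o) ->
  nbf_formula (fun q => a q *: ext u (f q)).
Proof.
move=> sa.
have se : sphere_section At f V (ext u \o f).
  split=> [|q Vq]; last exact: (sphere_field_ext u).2.
  rewrite (_ : _ \o f = (fun q => u + dot (- u) (f q) *: f q)).
    apply: smooth_mapD => //; first exact: smooth_map_cst.
    apply: smooth_mapZ => //; apply: smooth_map_dot => //.
    exact: smooth_map_cst.
  by apply/funext => q; rewrite /= extE.
split.
  split=> [|q Vq]; first exact: smooth_mapZ sa se.1.
  by rewrite dotZl se.2// mulr0.
rewrite (conn_leibniz (pb_connection hnbf) oV sX sa se Vp).
set v := der At f (X p) p.
have fv : dot v (f p) = 0 by exact: dot_der_position.
rewrite (pb_compose hnbf oV sX (sphere_field_ext v) (sphere_field_ext u) Vp);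
  last exact: ext_tangent.
rewrite (sphere_connectionE hnb (sphere_field_ext v) (sphere_field_ext u))//.
have eD := der_comp Vp (X p) fV
  (smooth_differentiable (smooth_ext u) (I : [set: _] (f p))).
rewrite (ext_tangent fv) -eD /projected_der (derZ Vp _ sa se.1).
rewrite dotDl dotZl (se.2 p Vp) mulr0 add0r dotZl -scalerA.
by rewrite (scalerBr (a p)) addrA.
Qed.

Lemma pullback_connectionE s : sphere_section At f V s ->
  nbf X s p = der At s (X p) p - dot (der At s (X p) p) (f p) *: f p.
Proof.
move=> ss.
pose s' : M -> 'rV[R]_7 := fun q => \sum_i dot (s q) 'e_i *: ext 'e_i (f q).
have ess' q : V q -> s q = s' q.
  move=> Vq.
  have term i : dot (s q) 'e_i *: ext 'e_i (f q) =
      s q 0 i *: 'e_i - (s q 0 i * f q 0 i) *: f q.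
    by rewrite /ext scalerBr scalerA (dotC 'e_i) !dot_delta.
  have sf0 : \sum_i s q 0 i * f q 0 i = 0 by exact: ss.2 q Vq.
  rewrite /s' (eq_bigr _ (fun i _ => term i)) sumrB -row_sum_delta.
  by rewrite -scaler_suml sf0 scale0r subr0.
have [ss' es'] : nbf_formula s'.
  rewrite (_ : s' = \sum_i (fun q => dot (s q) 'e_i *: ext 'e_i (f q))).
    apply: (big_ind nbf_formula) => [|? ?|i _].
    - exact: nbf_formula0.
    - exact: nbf_formulaD.
    - apply: nbf_formula_ext; apply: smooth_map_dot => //; first exact: ss.1.
      exact: smooth_map_cst.
  by apply/funext => q; rewrite fct_sumE.
rewrite (conn_local (pb_connection hnbf) oV sX sX ss ss'
  (fun _ _ => erefl) ess' Vp).
by rewrite es' /projected_der (der_eq _ oV Vp _ ess').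
Qed.

End AlongField.
End PullbackConnection.

(** * Lagrangian submanifolds *)

Section VectorIdentities.
Context {R : realType}.
Implicit Types (a b c d u v w x : 'rV[R]_7).

Lemma dot_inj n (u v : 'rV[R]_n) :
  (forall w : 'rV[R]_n, dot u w = dot v w) -> u = v.
Proof.
move=> uv; apply/eqP; rewrite -subr_eq0; apply/eqP; apply: dot_eq0.
by rewrite dotDl dotNl uv subrr.
Qed.

Lemma subr_cancel (A : zmodType) (a b c d u : A) :
  a - b = a + c - u - (b + d - u) -> c = d.
Proof.
rewrite opprB addrA addrNK opprD addrACA -[LHS]addr0 => /addrI/esym/eqP.
by rewrite subr_eq0 => /eqP.
Qed.

Lemma dot_cross_rot u v w : dot (cross u v) w = dot (cross v w) u.
Proof. by rewrite dot_cross_cyc dotC. Qed.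

Lemma dot_cross_swap u v w : dot (cross u v) w = - dot v (cross u w).
Proof. by rewrite crossC dotNl dot_cross_cyc. Qed.

Lemma metric_skew_normal n (n1 n2 h1 h2 x y z : 'rV[R]_n) (r s : R) :
  dot x z = 0 -> dot y x = 0 ->
  dot (n1 + h1 - r *: x) z + dot y (n2 + h2 - s *: x) = dot n1 z + dot y n2 ->
  dot h1 z = - dot h2 y.
Proof.
by move=> xz yx; rewrite !dotE_lin xz yx (dotC h2) => e; lra.
Qed.

Lemma normal_position n (u w x : 'rV[R]_n) (r : R) :
  dot x x = 1 -> dot u x = 0 -> dot (u + w - r *: x) x = - r -> dot w x = 0.
Proof. by move=> x1 ux; rewrite !dotE_lin x1 ux => e; lra. Qed.

Lemma cyclic_eq0 (t r s r' : R) :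
  t = r - s -> t = r' - r -> t = s - r' -> t = 0.
Proof. by lra. Qed.

Lemma cross_position u w x (r : R) :
  cross x (u + w - r *: x) = cross x u + cross x w.
Proof. by rewrite !crossDr crossNr crossZr crossxx scaler0 subr0. Qed.

Lemma cross_product_rule x c n1 h1 n2 h2 y z (r : R) :
  dot (cross x n1) z = 0 -> dot (cross x y) n2 = 0 ->
  dot (c + cross x n1 + cross x h1) z
    + dot (cross x y) (n2 + h2 - r *: x) = 0 ->
  dot c z = dot h1 (cross x z) - dot h2 (cross x y).
Proof.
have := dot_crossl x y; have := dot_cross_swap x h1 z; rewrite (dotC h2).
move: (cross x n1) (cross x h1) (cross x y) (cross x z) => a b d g e1 e2 e3 e4.
by rewrite !dotE_lin e1 e2 e3 e4 => e; lra.
Qed.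

Lemma cross_triple_rule x a b c n1 n2 n3 h1 h2 h3 (r1 r2 r3 : R) :
  dot (cross x a) b = 0 -> dot (cross x b) c = 0 -> dot (cross x a) c = 0 ->
  dot (cross n1 b) c = 0 -> dot (cross a n2) c = 0 -> dot (cross a b) n3 = 0 ->
  dot (cross (n1 + h1 - r1 *: x) b + cross a (n2 + h2 - r2 *: x)) c
    + dot (cross a b) (n3 + h3 - r3 *: x) = 0 ->
  dot h1 (cross b c) + dot h2 (cross c a) + dot h3 (cross a b) = 0.
Proof.
move=> e1 e2 e3 e4 e5 e6.
have e7 : dot (cross a b) x = 0 by rewrite -dot_cross_rot.
have e8 : dot (cross a x) c = 0 by rewrite crossC dotNl e3 oppr0.
have -> : dot h1 (cross b c) = dot (cross h1 b) c by rewrite dot_cross_cyc.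
have -> : dot h2 (cross c a) = dot (cross a h2) c.
  by rewrite -dot_cross_cyc -dot_cross_rot.
rewrite !crossDl !crossDr crossNl crossNr crossZl crossZr (dotC h3).
move: (cross n1 b) (cross h1 b) (cross x b) (cross a n2) (cross a h2)
  (cross a x) (cross a b) e2 e4 e5 e6 e7 e8 => v1 v2 v3 v4 v5 v6 v7.
move=> e2 e4 e5 e6 e7 e8; rewrite !dotE_lin e2 e4 e5 e6 e7 e8 => e; lra.
Qed.

Lemma dot_crossN a b c : dot (cross a b) c = - dot (cross b a) c.
Proof. by rewrite crossC dotNl. Qed.

Lemma dot_cross_J_alt x a b c : dot a x = 0 -> dot b x = 0 -> dot c x = 0 ->
  dot (cross a b) (cross x c) = - dot (cross a c) (cross x b).
Proof.
move=> ax bx cx; have := dot_cross_cross a b x c.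
by rewrite ax bx (dotC x c) cx; lra.
Qed.

Lemma dot_cross_self a b : dot a a = 1 -> dot b b = 1 -> dot a b = 0 ->
  dot (cross a b) (cross a b) = 1.
Proof.
move=> aa bb ab; have := dot_cross_cross a b a b.
by rewrite aa bb ab (dotC b a) ab; lra.
Qed.

Lemma dot_normal_part n (d t u x w : 'rV[R]_n) (r : R) :
  dot t w = 0 -> dot x w = 0 -> d - r *: x = t + u -> dot u w = dot d w.
Proof.
move=> tw xw e; have := congr1 (fun y => dot y w) e.
by rewrite !dotE_lin tw xw mulr0 subr0 add0r.
Qed.

Lemma dot_pushf_normal n (u v x w : 'rV[R]_n) (r : R) :
  dot u w = 0 -> dot x w = 0 -> dot (u + v - r *: x) w = dot v w.
Proof. by move=> uw xw; rewrite !dotE_lin uw xw mulr0 subr0 add0r. Qed.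

Lemma codazzi_rule n (d u v t x w : 'rV[R]_n) (r s : R) :
  dot t w = 0 -> dot x w = 0 ->
  d = u + v - (s *: x + r *: t) -> dot v w = dot d w - dot u w.
Proof.
by move=> tw xw ->; rewrite !dotE_lin tw xw; ring.
Qed.

Lemma dotBBl n (a b c w : 'rV[R]_n) :
  dot (a - b - c) w = dot a w - dot b w - dot c w.
Proof. by rewrite !dotE_lin. Qed.

Lemma add3_eq0 (a b c a' b' c' : R) :
  a = a' -> b = b' -> c = c' -> a + b + c = 0 -> a' + b' + c' = 0.
Proof. by move=> -> -> ->. Qed.

Lemma sub2_exchange (r r' d d' a a' b b' : R) :
  r = d - a - b -> r' = d' - b' - a' -> d = d' -> a = a' -> b = b' -> r = r'.
Proof. by move=> -> -> -> -> ->; rewrite addrAC. Qed.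

Lemma add3_congr (a b c a' b' c' : R) :
  a = a' -> b = b' -> c = c' -> a + b + c = a' + b' + c'.
Proof. by move=> -> -> ->. Qed.

Lemma sum5_regroup (d r a b c s a' b' s' : R) :
  d = r + a + b + c + s -> a = a' -> b = b' -> s = s' ->
  d = r + s' + (a' + b') + c.
Proof. by move=> -> -> -> ->; ring. Qed.

Lemma product_rule_cancel (I : finType)
    (dx dy r r' g g' c c' x y : I -> I -> R) :
  (forall i j, dx i j = r i j + g i j + c i j) ->
  (forall i j, dy i j = r' i j + g' i j + c' i j) ->
  \sum_i \sum_j (g i j * y i j + g' i j * x i j) = 0 ->
  \sum_i \sum_j (dx i j * y i j + x i j * dy i j)
    - \sum_i \sum_j c i j * y i j - \sum_i \sum_j x i j * c' i j =
  \sum_i \sum_j (r i j * y i j + r' i j * x i j).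
Proof.
move=> dxE dyE g0; rewrite -[RHS]addr0 -[X in _ = _ + X]g0.
rewrite -!sumrB -big_split /=.
apply: eq_bigr => i _; rewrite -!sumrB -big_split /=.
by apply: eq_bigr => j _; rewrite dxE dyE; ring.
Qed.

Lemma dot_correction n (a b c d w : 'rV[R]_n) (r : R) :
  dot (a - r *: (b + c + d)) w = dot a w - r * (dot b w + dot c w + dot d w).
Proof. by rewrite !dotE_lin. Qed.

Lemma codazzi_cancel (r r' d d' a a' b b' s s' : R) :
  r = d - a - b -> r' = d' - a' - b' -> d = s - b' -> d' = s' - b ->
  a - a' = s - s' -> r = r'.
Proof. by lra. Qed.

Lemma sum5_cancel (d d' r r' a a' b b' c c' s s' : R) :
  d = r + a + b + c + s -> d' = r' + a' + c' + b' + s' -> d = d' ->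
  a = a' -> b = b' -> c = c' -> r + s = r' + s'.
Proof. by lra. Qed.

Lemma der_cubic_rule n (w w' a u v y g : 'rV[R]_n) (d r c1 c2 : R) :
  d = dot w w' + dot a u -> u = v + y + g -> dot a g = 0 ->
  r = dot w w' - c1 - c2 -> d = r + c1 + c2 + dot a y + dot a v.
Proof. by move=> -> ->; rewrite !dotE_lin => -> ->; ring. Qed.

Lemma dot_sub_eq n (d a b c c' w : 'rV[R]_n) (r r' : R) :
  d = a - b -> d = c - c' -> dot a w = r -> dot b w = r' ->
  r - r' = dot c w - dot c' w.
Proof. by move=> -> e <- <-; rewrite -!dotNl -!dotDl e. Qed.

Lemma linear_sub (U U' : lmodType R) (L : U -> U') (y z : U) :
  linear L -> L (y - z) = L y - L z.
Proof.
move=> linL; have := linL (-1) z y; rewrite !scaleN1r (addrC y) => ->.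
exact: addrC.
Qed.

Lemma dot_cross_sum (I : finType) (b a w : 'rV[R]_7) (c : I -> R)
    (u : I -> 'rV[R]_7) : a = \sum_i c i *: u i ->
  dot (cross b a) w = \sum_i c i * dot (cross b (u i)) w.
Proof.
move=> ->; rewrite dotC cross_sumr dot_sumr.
by apply: eq_bigr => i _; rewrite crossZr dotZr (dotC w).
Qed.

Lemma dot_JJ x a b : dot x x = 1 -> dot a x = 0 -> dot b x = 0 ->
  dot (cross x a) (cross x b) = dot a b.
Proof.
move=> x1 ax bx; have := dot_cross_cross x a x b.
by rewrite x1 ax (dotC x b) bx (dotC (cross x b)); lra.
Qed.

Lemma dot_J_sum (I : finType) (b a w : 'rV[R]_7) (c : I -> R)
    (u : I -> 'rV[R]_7) : a = \sum_i c i *: u i ->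
  dot w (cross b a) = \sum_i c i * dot w (cross b (u i)).
Proof.
move=> /(dot_cross_sum b w); rewrite dotC => ->.
by apply: eq_bigr => i _; rewrite (dotC w).
Qed.

Lemma J_expansion (I : finType) x a (u : I -> 'rV[R]_7) w :
  dot x x = 1 -> dot a x = 0 -> (forall i, dot (u i) x = 0) ->
  a = \sum_i dot a (u i) *: u i ->
  dot (cross x a) w =
    \sum_i dot w (cross x (u i)) * dot (cross x a) (cross x (u i)).
Proof.
move=> x1 ax ux ea; rewrite dotC {1}ea cross_sumr dot_sumr.
by apply: eq_bigr => i _; rewrite crossZr dotZr dot_JJ// mulrC.
Qed.

End VectorIdentities.

Section Lagrangian.
Context {R : realType} {M : topologicalType} {At : atlas R M}.
Context {f : M -> 'rV[R]_7}.
Hypothesis hf : lagrangian At f.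
Context {nb : ('rV[R]_7 -> 'rV[R]_7) -> ('rV[R]_7 -> 'rV[R]_7) ->
              'rV[R]_7 -> 'rV[R]_7}.
Hypothesis hnb : sphere_levi_civita nb.
Context {nbf : (M -> 'rV[R]_3) -> (M -> 'rV[R]_7) -> M -> 'rV[R]_7}.
Hypothesis hnbf : pullback_connection At f nb nbf.
Context {nabla : (M -> 'rV[R]_3) -> (M -> 'rV[R]_3) -> M -> 'rV[R]_3}.
Hypothesis hnabla : levi_civita At f nabla.
Context {nperp : (M -> 'rV[R]_3) -> (M -> 'rV[R]_7) -> M -> 'rV[R]_7}.
Hypothesis hnperp : normal_connection At f nbf nperp.
Context {Ash : (M -> 'rV[R]_7) -> (M -> 'rV[R]_3) -> M -> 'rV[R]_3}.
Hypothesis hAsh : shape_operator At f nbf nabla Ash.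
Context {V : set M}.
Hypothesis oV : open V.
Context {e : 'I_3 -> M -> 'rV[R]_3}.
Hypothesis he : oriented_orthonormal_frame At f nb V e.

Implicit Types (X Y Z W : M -> 'rV[R]_3) (p q : M) (i j k l m : 'I_3).

Local Notation SF := (smooth_field At V).
Local Notation F := (pushf At f).
Local Notation J := (Jf At f).
Local Notation h := (sff At f nbf nabla).

Let fT p : sphere6 (f p). Proof. exact: (lag_sphere hf p). Qed.

Let smf : smooth_map At V f.
Proof. by apply: smooth_map_sub (lag_smooth hf). Qed.

Let tangent_f p v : dot (der At f v p) (f p) = 0.
Proof. exact: (dot_der_position (lag_smooth hf) fT). Qed.

Let f_tangent p v : dot (f p) (der At f v p) = 0.
Proof. by rewrite dotC. Qed.

Let smF X : SF X -> smooth_map At V (F X).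
Proof. exact: smooth_map_der. Qed.

Let smJ X : SF X -> smooth_map At V (J X).
Proof. by move=> sX; apply: smooth_map_cross (smF sX). Qed.

Let sN X Y : SF X -> SF Y -> SF (nabla X Y).
Proof. exact: (conn_section (lc_connection hnabla) oV). Qed.

Let J_normal p v : normal_vector At f p (cross (f p) (der At f v p)).
Proof. by apply/(lag_normal hf); exists v. Qed.

Let J_tangent p u v : dot (cross (f p) (der At f u p)) (der At f v p) = 0.
Proof. exact: (J_normal p u).2. Qed.

Lemma Gten_tangent p u v :
  Gten nb (f p) (der At f u p) (der At f v p) =
  cross (der At f u p) (der At f v p).
Proof.
rewrite GtenE// dot_cross_rot dot_cross_rot J_tangent.
by rewrite scale0r subr0.
Qed.

Let sphere_section_F X : SF X -> sphere_section At f V (F X).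
Proof. by move=> sX; split; [exact: smF|move=> p _; exact: tangent_f]. Qed.

Lemma der_pushf_position X Y p : SF X -> SF Y -> V p ->
  dot (der At (F Y) (X p) p) (f p) = - dot (F X p) (F Y p).
Proof.
move=> sX sY Vp; have := der_dot Vp (X p) (smF sY) smf.
rewrite (der_eq At oV Vp (G := fun _ => 0 : R^o) (X p)
  (fun q _ => tangent_f q (Y q))) der_cst (dotC (F Y p)).
by move=> /esym/eqP; rewrite addr_eq0 => /eqP.
Qed.

Lemma der_pushf X Y p : SF X -> SF Y -> V p ->
  der At (F Y) (X p) p =
  F (nabla X Y) p + h X Y p - dot (F X p) (F Y p) *: f p.
Proof.
move=> sX sY Vp; rewrite /h.
rewrite (pullback_connectionE (lag_smooth hf) fT hnb hnbf oV sX Vp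
  (sphere_section_F sY)) (der_pushf_position sX sY Vp).
by rewrite scaleNr opprK [X in _ = X - _]addrC subrK addrK.
Qed.

Let smh X Y : SF X -> SF Y -> smooth_map At V (h X Y).
Proof.
move=> sX sY; apply: (smooth_mapB oV (F := nbf X (F Y))).
  exact: (conn_section (pb_connection hnbf) oV sX (sphere_section_F sY)).1.
exact: smF (sN sX sY).
Qed.

Lemma torsion_free_rV X Y (G : M -> 'rV[R]_7) p : SF X -> SF Y ->
  smooth_map At V G -> V p ->
  der At G (nabla X Y p - nabla Y X p) p =
  der At (fun q => der At G (Y q) q) (X p) p
  - der At (fun q => der At G (X q) q) (Y p) p.
Proof.
move=> sX sY sG Vp; apply: dot_inj => w.
have sw : smooth_map At V (fun _ => w) by exact: smooth_map_cst.
have derw q (H : M -> 'rV[R]_7) v : V q -> smooth_map At V H ->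
    der At ((fun q => dot (H q) w) : M -> R^o) v q = dot (der At H v q) w.
  by move=> Vq sH; rewrite (der_dot Vq v sH sw) der_cst dot0r addr0.
have sGw : smooth_map At V ((fun q => dot (G q) w) : M -> R^o).
  exact: smooth_map_dot.
have := lc_torsion hnabla oV sX sY sGw Vp.
rewrite (derw _ _ _ Vp sG) dotDl dotNl => ->.
have sD Z : SF Z -> smooth_map At V (fun q => der At G (Z q) q).
  by move=> sZ; exact: smooth_map_der.
by congr (_ - _); rewrite -derw//; try exact: sD;
  apply: (der_eq At oV Vp) => q Vq; exact: derw.
Qed.

Lemma sff_sym X Y p : SF X -> SF Y -> V p -> h X Y p = h Y X p.
Proof.
move=> sX sY Vp.
have e1 := der_pushf sX sY Vp; have e2 := der_pushf sY sX Vp.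
have := torsion_free_rV sX sY smf Vp.
rewrite [X in _ = X - _]e1 [X in _ = _ - X]e2 (dotC (F Y p)).
have -> : der At f (nabla X Y p - nabla Y X p) p =
    F (nabla X Y) p - F (nabla Y X) p.
  rewrite addrC; have := der_linear Vp smf (-1) (nabla Y X p) (nabla X Y p).
  by rewrite !scaleN1r => ->; rewrite addrC.
exact: subr_cancel.
Qed.

Let se i : SF (e i). Proof. by have [se _ _] := he; exact: se. Qed.

Let ge i j p : V p -> dot (F (e i) p) (F (e j) p) = (i == j)%:R.
Proof. by have [_ ge _] := he => Vp; exact: ge. Qed.

Lemma frame_expansion p v : V p -> v = \sum_i gmet At f p v (e i p) *: e i p.
Proof.
move=> Vp.
have linf := der_linear Vp smf.
have ling w : linear (fun u => gmet At f p u w : R^o).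
  by move=> a u u'; rewrite /gmet linf !dotE_lin.
pose E := \matrix_(i < 3) e i p.
pose K := \matrix_(k < 3, j < 3) gmet At f p 'e_k (e j p).
have gK u j : gmet At f p u (e j p) = (u *m K) 0 j.
  rewrite (linear_rV_sum u (ling _)) mxE; apply: eq_bigr => k _.
  by rewrite mxE.
have EK : E *m K = 1%:M.
  apply/matrixP => i j.
  have -> : (1%:M : 'M[R]_3) i j = gmet At f p (e i p) (e j p).
    by rewrite mxE -(ge i j Vp).
  by rewrite gK !mxE; apply: eq_bigr => k _; rewrite !mxE.
rewrite -[LHS]mulmx1 -(mulmx1C EK) mulmxA mulmx_sum_row.
by apply: eq_bigr => j _; rewrite -gK rowK.
Qed.

Lemma tangent_extension p v : V p -> exists2 X, SF X & X p = v.
Proof.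
move=> Vp; pose c i := gmet At f p v (e i p).
exists (fun q => \sum_i c i *: e i q); last by rewrite -frame_expansion.
move=> q; have oVq : open (V `&` dom At q).
  by apply: openI => //; exact: dom_open.
apply: (smooth_map_eq oVq (F := fun r =>
    \sum_i c i *: der At (Defs.coord At q) (e i r) r)).
  move=> r [Vr qr].
  have linq := derive_linear (coord_differentiable qr).
  exact: (esym (linear_sumZ c (fun i => e i r) linq)).
apply: smooth_map_sum => // i; apply: smooth_mapZ => //.
  exact: smooth_map_cst.
exact: se.
Qed.

Lemma normal_vector_fields p w : V p -> dot w (f p) = 0 ->
  (forall X, SF X -> dot w (F X p) = 0) -> normal_vector At f p w.
Proof.
move=> Vp wf wF; split=> // v; have [X sX <-] := tangent_extension v Vp.
exact: wF.
Qed.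

Lemma sff_normal X Y p : SF X -> SF Y -> V p -> normal_vector At f p (h X Y p).
Proof.
move=> sX sY Vp; apply: normal_vector_fields => // [|Z sZ].
  have := der_pushf_position sX sY Vp.
  rewrite (der_pushf sX sY Vp).
  exact: normal_position (fT p) (tangent_f p (nabla X Y p)).
apply: (sym_skew_eq0 (P := smooth_field At V)
  (b := fun X Y Z => dot (h X Y p) (F Z p))) sX sY sZ.
  by move=> X' Y' Z' sX' sY'; rewrite (sff_sym sX' sY' Vp).
move=> X' Y' Z' sX' sY' sZ'.
have := lc_metric hnabla oV sX' sY' sZ' Vp.
rewrite [LHS](der_dot Vp (X' p) (smF sY') (smF sZ')).
rewrite (der_pushf sX' sY' Vp) (der_pushf sX' sZ' Vp).
exact: metric_skew_normal (f_tangent p (Z' p)) (tangent_f p (Y' p)).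
Qed.

Lemma der_Jf X Y p : SF X -> SF Y -> V p ->
  der At (J Y) (X p) p = cross (F X p) (F Y p) +
    cross (f p) (F (nabla X Y) p) + cross (f p) (h X Y p).
Proof.
move=> sX sY Vp; rewrite [LHS](der_cross Vp (X p) smf (smF sY)).
by rewrite (der_pushf sX sY Vp) cross_position addrA.
Qed.

Let cubic X Y Z p := dot (h X Y p) (J Z p).

Let cubicC12 X Y Z p : SF X -> SF Y -> V p -> cubic X Y Z p = cubic Y X Z p.
Proof. by move=> sX sY Vp; rewrite /cubic (sff_sym sX sY Vp). Qed.

Let cross_cubic X Y Z p : SF X -> SF Y -> SF Z -> V p ->
  dot (cross (F X p) (F Y p)) (F Z p) = cubic X Y Z p - cubic X Z Y p.
Proof.
move=> sX sY sZ Vp; have := der_dot Vp (X p) (smJ sY) (smF sZ).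
rewrite (der_eq At oV Vp (G := fun _ => 0 : R^o) (X p)
  (fun q _ => J_tangent q (Y q) (Z q))) der_cst.
rewrite (der_Jf sX sY Vp) (der_pushf sX sZ Vp) => /esym.
exact: cross_product_rule (J_tangent p _ _) (J_tangent p _ _).
Qed.

(* Antisymmetrizing the previous identity, the cubic form disappears. *)
Let cross_tangent0 X Y Z p : SF X -> SF Y -> SF Z -> V p ->
  dot (cross (F X p) (F Y p)) (F Z p) = 0.
Proof.
move=> sX sY sZ Vp.
have e1 := cross_cubic sX sY sZ Vp.
have e2 := cross_cubic sY sZ sX Vp; rewrite -dot_cross_rot in e2.
have e3 := cross_cubic sZ sX sY Vp; rewrite -2!dot_cross_rot in e3.
rewrite (cubicC12 _ sY sX Vp) in e2.
rewrite (cubicC12 _ sZ sX Vp) (cubicC12 _ sZ sY Vp) in e3.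
exact: cyclic_eq0 e1 e2 e3.
Qed.

Let cubicC23 X Y Z p : SF X -> SF Y -> SF Z -> V p ->
  cubic X Y Z p = cubic X Z Y p.
Proof.
move=> sX sY sZ Vp; have := cross_cubic sX sY sZ Vp.
by rewrite (cross_tangent0 sX sY sZ Vp) => /esym/subr0_eq.
Qed.

Lemma cross_normal p u v : V p ->
  normal_vector At f p (cross (der At f u p) (der At f v p)).
Proof.
move=> Vp; split=> [|w]; first by rewrite 2!dot_cross_rot J_tangent.
have [X sX <-] := tangent_extension u Vp.
have [Y sY <-] := tangent_extension v Vp.
have [Z sZ <-] := tangent_extension w Vp.
exact: cross_tangent0.
Qed.

Let tangent_expansion p v : V p ->
  der At f v p = \sum_m dot (der At f v p) (F (e m) p) *: F (e m) p.
Proof.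
move=> Vp; rewrite {1}(frame_expansion v Vp).
exact: (linear_sumZ _ _ (der_linear Vp smf)).
Qed.

Lemma normal_expansion p w w' : V p -> normal_vector At f p w ->
  dot w w' = \sum_m dot w' (J (e m) p) * dot w (J (e m) p).
Proof.
move=> Vp /(lag_normal hf)[v ->].
exact: J_expansion (fT p) (tangent_f p v) (fun m => tangent_f p (e m p))
  (tangent_expansion v Vp).
Qed.

Let omE i j k p :
  om_ At f nb e i j k p = dot (cross (F (e i) p) (F (e j) p)) (J (e k) p).
Proof. by rewrite /om_ /omega /Gf Gten_tangent. Qed.

Lemma om_eps3 i j k p : V p -> om_ At f nb e i j k p = eps3 i j k.
Proof.
move=> Vp.
apply: (alternating_eps3 (om := fun i j k => om_ At f nb e i j k p)).
- move=> i' j' k'; rewrite !omE; exact: dot_crossN.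
- move=> i' j' k'; rewrite !omE.
  exact: dot_cross_J_alt (tangent_f _ _) (tangent_f _ _) (tangent_f _ _).
- by have [_ _] := he; exact.
have ne : (inord 0 == inord 1 :> 'I_3) = false.
  by apply/negbTE/eqP => /(congr1 val); rewrite /= !inordK.
rewrite -[RHS](@dot_cross_self _ (F (e (inord 0)) p) (F (e (inord 1)) p));
  try by rewrite ge// ?eqxx ?ne.
rewrite (normal_expansion _ Vp (cross_normal _ _ Vp)).
by apply: eq_bigr => m _; rewrite omE expr2.
Qed.

Let dot_normal_cross w i j p : V p -> normal_vector At f p w ->
  dot w (cross (F (e i) p) (F (e j) p)) =
  \sum_m eps3 i j m * dot w (J (e m) p).
Proof.
move=> Vp nw.
apply: (etrans (normal_expansion _ Vp nw)); apply: eq_bigr => m _.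
by rewrite -omE om_eps3.
Qed.

Lemma sff_trace i p : V p -> \sum_m dot (h (e i) (e m) p) (J (e m) p) = 0.
Proof.
move=> Vp.
pose X := e (@Ordinal 3 0 isT); pose Y := e (@Ordinal 3 1 isT).
pose Z := e (@Ordinal 3 2 isT).
have sX : SF X by exact: se.
have sY : SF Y by exact: se.
have sZ : SF Z by exact: se.
have := der_dot Vp (e i p) (smooth_map_cross oV (smF sX) (smF sY)) (smF sZ).
rewrite (der_eq At oV Vp (G := fun _ => 0 : R^o) (e i p)
  (fun q Vq => cross_tangent0 sX sY sZ Vq)) der_cst.
rewrite (der_cross Vp (e i p) (smF sX) (smF sY)).
rewrite (der_pushf (se i) sX Vp) (der_pushf (se i) sY Vp)
  (der_pushf (se i) sZ Vp) => /esym e0.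
have e1 := cross_triple_rule (J_tangent p (X p) (Y p)) (J_tangent p (Y p) (Z p))
  (J_tangent p (X p) (Z p)) (cross_tangent0 (sN (se i) sX) sY sZ Vp)
  (cross_tangent0 sX (sN (se i) sY) sZ Vp)
  (cross_tangent0 sX sY (sN (se i) sZ) Vp) e0.
rewrite sum3; move: e1; apply: add3_eq0.
- exact: etrans (dot_normal_cross _ _ Vp (sff_normal (se i) sX Vp))
    (sum_eps12 (fun m => dot (h (e i) X p) (J (e m) p))).
- exact: etrans (dot_normal_cross _ _ Vp (sff_normal (se i) sY Vp))
    (sum_eps20 (fun m => dot (h (e i) Y p) (J (e m) p))).
- exact: etrans (dot_normal_cross _ _ Vp (sff_normal (se i) sZ Vp))
    (sum_eps01 (fun m => dot (h (e i) Z p) (J (e m) p))).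
Qed.

Local Notation N X Y Z W p :=
  (dot (nabla_sff At f nbf nabla nperp X Y Z p) (J W p)).

Let cov_der X Y Z W p : SF X -> SF Y -> SF Z -> SF W -> V p ->
  N X Y Z W p = dot (der At (h Y Z) (X p) p) (J W p)
                - cubic (nabla X Y) Z W p - cubic Y (nabla X Z) W p.
Proof.
move=> sX sY sZ sW Vp; rewrite [LHS]dotBBl; congr (_ - _ - _).
have nh : normal_section At f V (h Y Z).
  by split; [exact: smh|move=> q; exact: sff_normal].
have ssh : sphere_section At f V (h Y Z).
  by split; [exact: smh|move=> q Vq; exact: (sff_normal sY sZ Vq).1].
have [_ [v]] := hnperp oV sX nh Vp.
rewrite (pullback_connectionE (lag_smooth hf) fT hnb hnbf oV sX Vp ssh).
apply: dot_normal_part; first by rewrite dotC J_tangent.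
by rewrite dotC dot_crossl.
Qed.

Let cov_sym23 X Y Z W p : SF X -> SF Y -> SF Z -> SF W -> V p ->
  N X Y Z W p = N X Z Y W p.
Proof.
move=> sX sY sZ sW Vp.
exact: sub2_exchange (cov_der sX sY sZ sW Vp) (cov_der sX sZ sY sW Vp)
  (congr1 (fun y => dot y (J W p))
    (der_eq At oV Vp (X p) (fun q Vq => sff_sym sY sZ Vq)))
  (cubicC12 W (sN sX sY) sZ Vp) (cubicC12 W sY (sN sX sZ) Vp).
Qed.

Let der_pushf_J X Z W p : SF X -> SF Z -> SF W -> V p ->
  dot (der At (F Z) (X p) p) (J W p) = cubic X Z W p.
Proof.
move=> sX sZ sW Vp; rewrite (der_pushf sX sZ Vp).
apply: dot_pushf_normal; first by rewrite dotC J_tangent.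
by rewrite dotC dot_crossl.
Qed.

(* The flatness of [R^7] enters through [torsion_free_rV]. *)
Let cov_codazzi X Y Z W p : SF X -> SF Y -> SF Z -> SF W -> V p ->
  N X Y Z W p = N Y X Z W p.
Proof.
move=> sX sY sZ sW Vp.
have tJ X' : dot (F X' p) (J W p) = 0 by rewrite dotC J_tangent.
have fJ : dot (f p) (J W p) = 0 by rewrite dotC dot_crossl.
have dh X' Y' : SF X' -> SF Y' ->
    dot (der At (h Y' Z) (X' p) p) (J W p) =
    dot (der At (fun q => der At (F Z) (Y' q) q) (X' p) p) (J W p)
    - cubic X' (nabla Y' Z) W p.
  move=> sX' sY'; have sg := smooth_map_dot oV (smF sY') (smF sZ).
  have sn := sN sY' sZ.
  have E := etrans (der_eq At oV Vp (X' p) (fun q Vq => der_pushf sY' sZ Vq))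
    (etrans (derB Vp (X' p) (smooth_mapD oV (smF sn) (smh sY' sZ))
               (smooth_mapZ oV sg smf))
      (congr2 (fun a b => a - b) (derD Vp (X' p) (smF sn) (smh sY' sZ))
        (derZ Vp (X' p) sg smf))).
  exact: etrans (codazzi_rule (tJ X') fJ E)
    (congr1 (fun c => _ - c) (der_pushf_J sX' sn sW Vp)).
exact: codazzi_cancel (cov_der sX sY sZ sW Vp) (cov_der sY sX sZ sW Vp)
  (dh _ _ sX sY) (dh _ _ sY sX)
  (dot_sub_eq (linear_sub _ _ (der_linear Vp (smF sZ)))
    (torsion_free_rV sX sY (smF sZ) Vp)
    (der_pushf_J (sN sX sY) sZ sW Vp) (der_pushf_J (sN sY sX) sZ sW Vp)).
Qed.

Let dot_normal_J Y Z w p : SF Y -> SF Z -> V p -> normal_vector At f p w ->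
  dot (h Y Z p) (cross (f p) w) = 0.
Proof.
move=> sY sZ Vp nw; have /(lag_normal hf)[v ->] := sff_normal sY sZ Vp.
apply: (etrans (dot_JJ (fT p) (tangent_f p v) nw.1)).
by rewrite dotC; exact: nw.2.
Qed.

Let der_cubic X Y Z W p : SF X -> SF Y -> SF Z -> SF W -> V p ->
  der At (cubic Y Z W : M -> R^o) (X p) p =
  N X Y Z W p + cubic (nabla X Y) Z W p + cubic Y (nabla X Z) W p
  + cubic Y Z (nabla X W) p + dot (h Y Z p) (cross (F X p) (F W p)).
Proof.
move=> sX sY sZ sW Vp.
exact: der_cubic_rule (der_dot Vp (X p) (smh sY sZ) (smJ sW))
  (der_Jf sX sW Vp) (dot_normal_J sY sZ Vp (sff_normal sX sW Vp))
  (cov_der sX sY sZ sW Vp).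
Qed.

Let cov_sym34 X Y Z W p : SF X -> SF Y -> SF Z -> SF W -> V p ->
  N X Y Z W p + dot (h Y Z p) (cross (F X p) (F W p)) =
  N X Y W Z p + dot (h Y W p) (cross (F X p) (F Z p)).
Proof.
move=> sX sY sZ sW Vp.
exact: sum5_cancel (der_cubic sX sY sZ sW Vp) (der_cubic sX sY sW sZ Vp)
  (@der_eq _ _ At V oV p Vp R^o (cubic Y Z W) (cubic Y W Z) (X p)
    (fun q Vq => cubicC23 sY sZ sW Vq))
  (cubicC23 (sN sX sY) sZ sW Vp) (cubicC23 sY (sN sX sZ) sW Vp)
  (cubicC23 sY sZ (sN sX sW) Vp).
Qed.

Let smooth_cubic X Y Z : SF X -> SF Y -> SF Z ->
  smooth_map At V (cubic X Y Z : M -> R^o).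
Proof.
move=> sX sY sZ; have s := smooth_map_dot oV (smh sX sY) (smJ sZ); exact s.
Qed.

Let cubic_frame X Y U p : V p ->
  cubic X Y U p = \sum_m gmet At f p (U p) (e m p) * cubic X Y (e m) p.
Proof. by move=> Vp; exact: dot_J_sum (tangent_expansion (U p) Vp). Qed.

Section AtPoint.
Context {p : M}.
Hypothesis Vp : V p.

Let hc i j k := h_ At f nbf nabla e i j k p.
Let Nc l i j k := N (e l) (e i) (e j) (e k) p.

Let hcC12 i j k : hc i j k = hc j i k.
Proof. exact (cubicC12 (e k) (se i) (se j) Vp). Qed.

Let hcC23 i j k : hc i j k = hc i k j.
Proof. exact (cubicC23 (se i) (se j) (se k) Vp). Qed.

Let hc_trace i : \sum_m hc i m m = 0.
Proof. exact (sff_trace i Vp). Qed.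

Let hc_cross a b l i :
  dot (h (e a) (e b) p) (cross (F (e l) p) (F (e i) p)) =
  \sum_m eps3 l i m * hc a b m.
Proof. exact (dot_normal_cross l i Vp (sff_normal (se a) (se b) Vp)). Qed.

Let NcC12 l i j k : Nc l i j k = Nc i l j k.
Proof. exact (cov_codazzi (se l) (se i) (se j) (se k) Vp). Qed.

Let NcC23 l i j k : Nc l i j k = Nc l j i k.
Proof. exact (cov_sym23 (se l) (se i) (se j) (se k) Vp). Qed.

Let NcC34 l i j k :
  Nc l i j k + \sum_m eps3 l k m * hc i j m =
  Nc l i k j + \sum_m eps3 l j m * hc i k m.
Proof.
exact (etrans
  (congr1 (fun c => Nc l i j k + c) (esym (hc_cross i j l k)))
  (etrans (cov_sym34 (se l) (se i) (se j) (se k) Vp)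
    (congr1 (fun c => Nc l i k j + c) (hc_cross i k l j)))).
Qed.

Let shape_correction l j i k :
  dot (Gf At f nb (e l) (Ash (J (e j)) (e i)) p) (J (e k) p) =
  \sum_m hc i m j * eps3 l m k.
Proof.
have nJ : normal_section At f V (J (e j)).
  by split; [exact: smJ|move=> q _; exact: J_normal].
apply: etrans (congr1 (fun y => dot y (J (e k) p))
  (Gten_tangent p (e l p) (Ash (J (e j)) (e i) p))) _.
apply: etrans (dot_cross_sum _ _ (tangent_expansion _ Vp)) _.
apply: eq_bigr => m _; apply: congr2.
  exact (hAsh oV nJ (se i) (se m) Vp).
by apply: etrans (om_eps3 l m k Vp); rewrite omE.
Qed.

Lemma T_components l i j k :
  T_ At f nb nbf nabla nperp Ash e l i j k p =
  Nc l i j k - 4^-1 * codazzi_correction hc l i j k.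
Proof.
apply: etrans (dot_correction _ _ _ _ _ _) _.
apply: (congr1 (fun c => Nc l i j k - 4^-1 * c)).
rewrite /codazzi_correction big_split big_split /=.
exact: add3_congr (shape_correction l j i k) (shape_correction i l j k)
  (shape_correction j i l k).
Qed.

Let gam k a m := gmet At f p (nabla (e k) (e a) p) (e m p).

Let gam_skew k a b : gam k a b = - gam k b a.
Proof.
have := lc_metric hnabla oV (se k) (se a) (se b) Vp.
rewrite (@der_eq _ _ At V oV p Vp R^o _ (fun _ => (a == b)%:R) (e k p)
  (fun q Vq => ge a b Vq)) der_cst => /esym/eqP.
rewrite addr_eq0 => /eqP E; apply: (etrans E).
exact (congr1 (fun c => - c) (dotC _ _)).
Qed.

Let der_hc k a b i :
  der At (cubic (e a) (e b) (e i) : M -> R^o) (e k p) p =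
  (Nc k a b i + \sum_m eps3 k i m * hc a b m)
  + (\sum_m gam k a m * hc m b i + \sum_m gam k b m * hc a m i)
  + cubic (e a) (e b) (nabla (e k) (e i)) p.
Proof.
have s1 := sN (se k) (se a); have s2 := sN (se k) (se b).
have c1 : cubic (nabla (e k) (e a)) (e b) (e i) p =
    \sum_m gam k a m * hc m b i.
  apply: etrans (cubicC12 _ s1 (se b) Vp) _.
  apply: etrans (cubicC23 (se b) s1 (se i) Vp) _.
  apply: etrans (cubic_frame _ _ _ Vp) _.
  apply: eq_bigr => m _.
  exact (congr1 (fun c => gam k a m * c) (etrans (hcC23 b i m) (hcC12 b m i))).
have c2 : cubic (e a) (nabla (e k) (e b)) (e i) p =
    \sum_m gam k b m * hc a m i.
  apply: etrans (cubicC23 (se a) s2 (se i) Vp) _.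
  apply: etrans (cubic_frame _ _ _ Vp) _.
  apply: eq_bigr => m _.
  exact (congr1 (fun c => gam k b m * c) (hcC23 a i m)).
exact: sum5_regroup (der_cubic (se k) (se a) (se b) (se i) Vp) c1 c2
  (hc_cross a b k i).
Qed.

Lemma dS_components i j k :
  dS_ At f nbf nabla e i j k p =
  \sum_a \sum_b
    ((Nc k a b i + \sum_m eps3 k i m * hc a b m) * hc a b j
     + (Nc k a b j + \sum_m eps3 k j m * hc a b m) * hc a b i).
Proof.
have sc a b i' := smooth_cubic (se a) (se b) (se i').
have D : der At (Sten At f nbf nabla e (e i) (e j) : M -> R^o) (e k p) p =
    \sum_a \sum_b
      (der At (cubic (e a) (e b) (e i) : M -> R^o) (e k p) p * hc a b j
       + hc a b i * der At (cubic (e a) (e b) (e j) : M -> R^o) (e k p) p).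
  pose xy a b : M -> R^o :=
    fun q => cubic (e a) (e b) (e i) q * cubic (e a) (e b) (e j) q.
  have sxy a b : smooth_map At V (xy a b).
    exact (smooth_mapM oV (sc a b i) (sc a b j)).
  apply: etrans (der_sum (F := fun a q => \sum_b xy a b q : R^o) oV Vp
    (e k p) _) _.
    by move=> a; exact: smooth_map_sum.
  apply: eq_bigr => a _.
  apply: etrans (der_sum (F := xy a) oV Vp (e k p) (sxy a)) _.
  apply: eq_bigr => b _.
  exact (derM Vp (e k p) (sc a b i) (sc a b j)).
apply: etrans (congr1 (fun c => c - _ - _) D) _.
exact (product_rule_cancel (fun a b => der_hc k a b i)
  (fun a b => der_hc k a b j)
  (skew_contraction_eq0 (fun a b => hc a b i) (fun a b => hc a b j)
    (gam_skew k))).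
Qed.

Let Pc i j k := P_ At f nb nbf nabla nperp Ash e i j k p.
Let Sc i j := S_ At f nbf nabla e i j p.

Let Pc_components i j k : Pc i j k = \sum_a \sum_b
  hc a b i * (Nc a b j k - 4^-1 * codazzi_correction hc a b j k).
Proof.
apply: eq_bigr => a _; apply: eq_bigr => b _.
exact (congr1 (fun c => hc a b i * c) (T_components a b j k)).
Qed.

Lemma P_sym23 i j k : Pc i j k = Pc i k j.
Proof.
rewrite !Pc_components; apply: eq_bigr => a _; apply: eq_bigr => b _.
by apply: (congr1 (fun c => hc a b i * c)); exact: TC34.
Qed.

Lemma S_sym i j : Sc i j = Sc j i.
Proof. by apply: eq_bigr => a _; apply: eq_bigr => b _; exact: mulrC. Qed.

Lemma dS_decomposition_P i j k :
  dS_ At f nbf nabla e i j k p = Pc i j k + Pc j i k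
  + 4^-1 * \sum_m (eps3 k i m * Sc m j + eps3 k j m * Sc i m).
Proof.
apply: etrans (dS_components i j k) _.
apply: etrans (dS_decomposition hcC12 hcC23 hc_trace NcC12 NcC23 NcC34 i j k) _.
exact (congr2 (fun x y => x + y + _) (esym (Pc_components i j k))
  (esym (Pc_components j i k))).
Qed.

End AtPoint.

End Lagrangian.

Unset Implicit Arguments.

Theorem lemma3p1 (R : realType) (M : topologicalType) (At : atlas R M)
    (f : M -> 'rV[R]_7) (hf : lagrangian At f)
    (nb : ('rV[R]_7 -> 'rV[R]_7) -> ('rV[R]_7 -> 'rV[R]_7) ->
          'rV[R]_7 -> 'rV[R]_7)
    (hnb : sphere_levi_civita nb)
    (nbf : (M -> 'rV[R]_3) -> (M -> 'rV[R]_7) -> M -> 'rV[R]_7)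
    (hnbf : pullback_connection At f nb nbf)
    (nabla : (M -> 'rV[R]_3) -> (M -> 'rV[R]_3) -> M -> 'rV[R]_3)
    (hnabla : levi_civita At f nabla)
    (nperp : (M -> 'rV[R]_3) -> (M -> 'rV[R]_7) -> M -> 'rV[R]_7)
    (hnperp : normal_connection At f nbf nperp)
    (Ash : (M -> 'rV[R]_7) -> (M -> 'rV[R]_3) -> M -> 'rV[R]_3)
    (hAsh : shape_operator At f nbf nabla Ash)
    (V : set M) (hV : open V) (e : 'I_3 -> M -> 'rV[R]_3)
    (he : oriented_orthonormal_frame At f nb V e)
    (p : M) (hp : V p) :
  let om := fun i j k : 'I_3 => om_ At f nb e i j k p in
  let S := fun i j : 'I_3 => S_ At f nbf nabla e i j p in
  let dS := fun i j k : 'I_3 => dS_ At f nbf nabla e i j k p in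
  let P := fun i j k : 'I_3 => P_ At f nb nbf nabla nperp Ash e i j k p in
  let A := fun i j : 'I_3 => A_ At f nb nbf nabla nperp Ash e i j p in
  let D := fun i j k : 'I_3 =>
    4^-1 * \sum_m (om k i m * S m j + om k j m * S i m) in
  let s := s_ At f nbf nabla e p in
  let q := q_ At f nbf nabla e p in
  (forall i j k : 'I_3, dS i j k = P i j k + P j i k + D i j k) /\
  \sum_i \sum_j \sum_k dS i j k * dS i k j =
    \sum_i \sum_j \sum_k P i j k ^+ 2
    + 3 * (\sum_i \sum_j \sum_k P i j k * P j i k)
    + 2^-1 * (\sum_i \sum_j A i j * S i j)
    + 16^-1 * (s ^+ 2 - 3 * q).
Proof.
move=> om S dS P A D s q.
have omE i j k : om i j k = eps3 i j k.
  exact (om_eps3 hf hnb hnbf hnabla hV he i j k hp).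
have DE i j k : D i j k =
    4^-1 * \sum_m (eps3 k i m * S m j + eps3 k j m * S i m).
  by congr (_ * _); apply: eq_bigr => m _; rewrite !omE.
have dSE i j k : dS i j k = P i j k + P j i k + D i j k.
  rewrite DE.
  exact (dS_decomposition_P hf hnb hnbf hnabla hnperp hAsh hV he hp i j k).
have AE i j : A i j = 2^-1 * (\sum_a \sum_b eps3 i a b * P a b j
                              + \sum_a \sum_b eps3 j a b * P a b i).
  congr (_ * (_ + _)); apply: eq_bigr => a _; apply: eq_bigr => b _.
    exact (congr1 (fun c => c * P a b j) (omE i a b)).
  exact (congr1 (fun c => c * P a b i) (omE j a b)).
have sE : s = \sum_i S i i by apply: eq_bigr => i _; rewrite mxE.
have qE : q = \sum_i \sum_j S i j * S j i.
  apply: eq_bigr => i _; rewrite mxE; apply: eq_bigr => j _.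
  by rewrite !mxE.
have PC i j k : P i j k = P i k j.
  exact (P_sym23 hf hnb hnbf hnabla hnperp hAsh hV he hp i j k).
have SC i j : S i j = S j i by exact: S_sym.
split=> //; move: dSE DE AE sE qE PC SC.
clearbody om S dS P A D s q => dSE DE AE -> -> PC SC.
have -> : dS = fun i j k => P i j k + P j i k
    + 4^-1 * \sum_m (eps3 k i m * S m j + eps3 k j m * S i m).
  by do 3 (apply/funext => ?); rewrite dSE DE.
have -> : A = fun i j => 2^-1 * (\sum_a \sum_b eps3 i a b * P a b j
                                + \sum_a \sum_b eps3 j a b * P a b i).
  by do 2 (apply/funext => ?).
exact: dS_quadratic PC SC.
Qed.
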